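(* Let $n\ge1$ be an integer and let $\kappa,\lambda\in\mathbb{C}\setminus\mathbb{Z}$. The twisted affinized Cremmer-Gervais matrices $R_{CG(1/2n,0)}(\lambda)$ (with $q=e^{\pi i\kappa}$, $p=e^{\pi i\kappa/n}$) are trigonometric degenerations of Belavin's $R$-matrices $R_B(\lambda)$ (which depend on $\tau$ in the upper half plane). Up to multiplication by a nonzero scalar depending only on $\lambda$ and $\kappa$, the degeneration is given by $$\lim_{\mathrm{Im}\,\tau\to\infty}(G\otimes G)^{-1}R_B(\lambda)(G\otimes G)=R_{CG(1/2n,0)}(\lambda),$$ where $G=G(\tau)$ is the diagonal matrix $G_{ab}=\delta_{ab}\,e^{-\pi i(a-\frac{n-1}{2})^2\tau/n}$ for $a,b=0,\dots,n-1$.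
   Context: All matrices act on $\mathbb{C}^n\otimes\mathbb{C}^n$, with matrix coefficients defined by $R(e_i\otimes e_j)=\sum_{k,l}R_{ij}^{kl}e_k\otimes e_l$, indices in $\{0,\dots,n-1\}$. Belavin's $R$-matrix here is the matrix, in the basis $\{\psi_a\otimes\psi_b\}$, of the twisted elliptic Shibukawa-Ueno operator $\mathcal{R}^e_{1/2n,\kappa/2n}(\lambda)$ restricted to $V^e_n\otimes V^e_n$. In detail: $\theta(z)=\vartheta_1(z,\tau)=-\sum_{m\in\mathbb{Z}}\exp\{\pi i(m+\frac12)^2\tau+2\pi i(m+\frac12)(z+\frac12)\}$, $G_\theta(z,\lambda)=\frac{\theta'(0)\theta(z+\lambda)}{\theta(z)\theta(\lambda)}$, and for meromorphic $f$ on $\mathbb{C}^2$ $$\mathcal{R}^e_{\alpha,\beta}(\lambda)\cdot f(z_1,z_2)=G_\theta(z_1-z_2-2(\alpha\lambda+\beta),\lambda)f(z_2+2\alpha\lambda,z_1-2\alpha\lambda)-G_\theta(z_1-z_2-2(\alpha\lambda+\beta),\kappa)f(z_1-2\beta,z_2+2\beta),$$ with $\alpha=1/(2n)$, $\beta=\kappa/(2n)$. The space $V^e_n$ of holomorphic $f$ on $\mathbb{C}$ with $f(z+1)=(-1)^{n-1}f(z)$, $f(z+\tau)=e^{-\pi in\tau-2\pi inz}f(z)$ has basis $\psi_a(z)=\sum_{m\equiv a\,(n)}e^{\pi i(m-\frac{n-1}{2})^2\tau/n+2\pi i(m-\frac{n-1}{2})z}$, $a=0,\dots,n-1$; $V^e_n\otimes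 V^e_n$ (the span of the $\psi_a(z_1)\psi_b(z_2)$) is invariant under this operator. Explicitly, with $\theta_{a,b}(z,\tau)=\sum_{m\in\mathbb{Z}}\exp\{\pi i(m+a)^2\tau+2\pi i(m+a)(z+b)\}$, $$R_B(\lambda)_{ij}^{kl}=\delta_{i+j,k+l\,(n)}\frac{\theta_{\frac12,\frac12}'(0,n\tau)\,\theta_{\frac{i-j}{n}+\frac12,\frac12}(\lambda-\kappa,n\tau)}{\theta_{\frac{i-k}{n}+\frac12,\frac12}(-\kappa,n\tau)\,\theta_{\frac{k-j}{n}+\frac12,\frac12}(\lambda,n\tau)},$$ where $\delta_{i+j,k+l\,(n)}=1$ if $i+j\equiv k+l$ mod $n$, and $0$ otherwise. Twisted affinized Cremmer-Gervais matrices: write $\hat x=x-x^{-1}$, $\widehat{q\eta^{-1}}=q\eta^{-1}-q^{-1}\eta$, $\eta=e^{\pi i\lambda}$, $p^n=q$; $$R_{CG}(\lambda)_{ij}^{kl}=p^{2(j-k)}\begin{cases}\widehat{q\eta^{-1}} & i=j=k=l,\\ -\hat\eta\,q^{\mathrm{sgn}(i-j)} & i=k\ne l=j,\\ \mathrm{sgn}(j-i)\,\hat\eta\,\hat q & \min(i,j)<k<\max(i,j),\ i+j=k+l,\\ \hat q\,\eta^{\mathrm{sgn}(j-i)} & j=k\ne l=i,\\ 0&\text{otherwise,}\end{cases}$$ and $R_{CG(\alpha,\beta)}(\lambda)_{ij}^{kl}=e^{4\pi i\alpha\lambda(i-k)}e^{4\pi i\beta(j-k)}R_{CG}(\lambda)_{ij}^{kl}$;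 here $\alpha=1/(2n)$, $\beta=0$. *)

(* Defs.v *)
From HB Require Import structures.
From mathcomp Require Import all_boot all_order all_algebra.
From mathcomp Require Export complex mxtens.
From mathcomp Require Import all_classical all_reals all_analysis.

Set Implicit Arguments.
Unset Strict Implicit.
Unset Printing Implicit Defensive.

Import Order.TTheory GRing.Theory Num.Theory numFieldNormedType.Exports.

Local Open Scope classical_set_scope.
Local Open Scope ring_scope.

(* The type R[i] carries no topology; seen through its numClosedFieldType
   structure it inherits the norm topology of numFieldNormedType. *)
Definition Cplx (R : realType) : numClosedFieldType := R[i]%C.

Section Elliptic.
Variable R : realType.
Local Notation C := (Cplx R).

Definition imunit : C := Complex 0 1.
Definition cpi : C := Complex pi 0.
Definition cexp (z : C) : C :=
  Complex (expR (complex.Re z) * cos (complex.Im z))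
          (expR (complex.Re z) * sin (complex.Im z)).

(* The filter Im tau --> +oo; Re tau is unconstrained. *)
Definition im_pinfty : set_system C :=
  filter_from [set: R] (fun M => [set tau : C | M < complex.Im tau]).

Global Instance im_pinfty_proper_filter : ProperFilter im_pinfty.
Proof.
apply: filter_from_proper; last first.
  by move=> M _; exists (Complex 0 (M + 1) : C); rewrite /= ltrDl.
apply: filter_from_filter; first by exists 0.
move=> M N _ _; exists (Num.max M N) => // tau /=.
by rewrite gt_max => /andP[].
Qed.

(* Two-sided series, summed over m >= 0 and m <= -1 separately; every series
   below converges absolutely when Im tau > 0. *)
Definition sumZ (f : int -> C) : C :=
  limn (series (fun k : nat => f (Posz k))) +
  limn (series (fun k : nat => f (Negz k))).

Definition theta_char (a b tau z : C) : C :=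
  sumZ (fun m => cexp (cpi * imunit * (m%:~R + a) ^+ 2 * tau
                       + 2 * cpi * imunit * (m%:~R + a) * (z + b))).

Definition theta1 (tau z : C) : C := - theta_char (1 / 2) (1 / 2) tau z.

Definition G_theta (tau z lambda : C) : C :=
  derive1 (theta1 tau) 0 * theta1 tau (z + lambda)
  / (theta1 tau z * theta1 tau lambda).

Definition shibukawa_ueno (tau alpha beta kappa lambda : C) (f : C -> C -> C)
    (z1 z2 : C) : C :=
  G_theta tau (z1 - z2 - 2 * (alpha * lambda + beta)) lambda
    * f (z2 + 2 * alpha * lambda) (z1 - 2 * alpha * lambda)
  - G_theta tau (z1 - z2 - 2 * (alpha * lambda + beta)) kappa
    * f (z1 - 2 * beta) (z2 + 2 * beta).

(* The integers m = a mod n are written m = a + n r. *)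
Definition psi (n : nat) (tau : C) (a : nat) (z : C) : C :=
  let s (r : int) : C :=
    a%:R + n%:R * r%:~R - (n%:R - 1) / 2 in
  sumZ (fun r => cexp (cpi * imunit * s r ^+ 2 * tau / n%:R
                       + 2 * cpi * imunit * s r * z)).

(* c i j k l stands for R_{ij}^{kl} in
   R (e_i (x) e_j) = \sum_(k, l) R_{ij}^{kl} e_k (x) e_l,
   with matrices acting on column vectors: (i, j) indexes the column. *)
Definition coef_mx (n : nat) (c : 'I_n -> 'I_n -> 'I_n -> 'I_n -> C) :
    'M[C]_(n * n) :=
  \matrix_(r, s) c (mxtens_unindex s).1 (mxtens_unindex s).2
                   (mxtens_unindex r).1 (mxtens_unindex r).2.

(* M is the matrix of the operator with alpha = 1/2n, beta = kappa/2n in the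
   basis psi_a (x) psi_b.  The functions are meromorphic: they are compared off
   the zeros of theta(z1 - z2 - 2 (alpha lambda + beta)). *)
Definition shibukawa_ueno_mx (n : nat) (kappa lambda tau : C)
    (M : 'M[C]_(n * n)) : Prop :=
  let alpha : C := 1 / (2 * n%:R) in
  let beta : C := kappa / (2 * n%:R) in
  forall (i j : 'I_n) (z1 z2 : C),
    theta1 tau (z1 - z2 - 2 * (alpha * lambda + beta)) != 0 ->
    shibukawa_ueno tau alpha beta kappa lambda
      (fun x y => psi n tau i x * psi n tau j y) z1 z2
    = \sum_(k < n) \sum_(l < n)
        M (mxtens_index (k, l)) (mxtens_index (i, j))
        * (psi n tau k z1 * psi n tau l z2).

Definition belavin_R (n : nat) (kappa lambda tau : C) : 'M[C]_(n * n) :=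
  let N : C := n%:R in
  let th (a z : C) := theta_char (a + 1 / 2) (1 / 2) (N * tau) z in
  coef_mx (fun i j k l : 'I_n =>
    if (i + j == k + l %[mod n])%N then
      derive1 (theta_char (1 / 2) (1 / 2) (N * tau)) 0
      * th ((i%:R - j%:R) / N) (lambda - kappa)
      / (th ((i%:R - k%:R) / N) (- kappa) * th ((k%:R - j%:R) / N) lambda)
    else 0).

Definition gauge (n : nat) (tau : C) : 'M[C]_n :=
  \matrix_(a, b) if a == b then
    cexp (- (cpi * imunit * (a%:R - (n%:R - 1) / 2) ^+ 2 * tau / n%:R))
  else 0.

Definition gauge_conj (n : nat) (tau : C) (M : 'M[C]_(n * n)) : 'M[C]_(n * n) :=
  invmx (gauge n tau *t gauge n tau) *m M *m (gauge n tau *t gauge n tau).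

Definition hat (x : C) : C := x - x^-1.

Definition sgn_diff (i j : nat) : int := Num.sg (Posz i - Posz j).

Definition CG_coef (n : nat) (q p eta : C) (i j k l : 'I_n) : C :=
  p ^ (2 * (Posz j - Posz k)) *
  (if [&& i == j, j == k & k == l] then hat (q * eta^-1)
   else if [&& i == k, k != l & l == j] then - hat eta * q ^ sgn_diff i j
   else if (minn i j < k < maxn i j)%N && (i + j == k + l)%N then
     (sgn_diff j i)%:~R * hat eta * hat q
   else if [&& j == k, k != l & l == i] then hat q * eta ^ sgn_diff j i
   else 0).

Definition twisted_CG (n : nat) (alpha beta kappa lambda : C) :
    'M[C]_(n * n) :=
  let q := cexp (cpi * imunit * kappa) in
  let p := cexp (cpi * imunit * kappa / n%:R) in
  let eta := cexp (cpi * imunit * lambda) in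
  coef_mx (fun i j k l : 'I_n =>
    cexp (4 * cpi * imunit * alpha * lambda * (i%:R - k%:R))
    * cexp (4 * cpi * imunit * beta * (j%:R - k%:R))
    * CG_coef q p eta i j k l).

End Elliptic.

Arguments im_pinfty R : clear implicits.

(* Main.v *)
(* As Im tau -> +oo a theta series divided by the largest of its exponentials
   tends to the sum of its dominant terms, by dominated convergence for series
   (Tannery), the Gaussian decay being uniform for Im tau >= 1; the same
   argument on difference quotients gives theta'(0).

   For the explicit matrix, all powers of the nome in a gauged coefficient
   combine, with T = n tau, into exp(pi i T M / n) for an integer M >= 0 which
   vanishes exactly when i + j = k + l (not only modulo n) and k lies between i
   and j; the surviving leading terms are the Cremmer-Gervais coefficients.

   For the matrix of the elliptic operator, no theta identity is needed.  The
   gauged psi_a(z) tends to exp(2 pi i (a - (n-1)/2) z) and G_theta to its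
   trigonometric counterpart, so the gauged operator converges at every point
   (z1, z2) off the poles.  Sampling on an n x n grid turns the matrix equation
   into V = A^T X B, where A and B tend to invertible Vandermonde-like matrices;
   hence X converges, and its limit is read off from the action of the
   trigonometric operator on exponentials, a finite geometric sum. *)

Require Import Defs.
From HB Require Import structures.
From mathcomp Require Import all_boot all_order all_algebra.
From mathcomp Require Import all_classical all_reals all_analysis.
From mathcomp Require Import ring lra zify.
Import Order.TTheory GRing.Theory Num.Theory numFieldNormedType.Exports.
Local Open Scope classical_set_scope.
Local Open Scope ring_scope.

Set Implicit Arguments.
Unset Strict Implicit.
Unset Printing Implicit Defensive.

Local Notation re := (@complex.Re _).
Local Notation im := (@complex.Im _).
Local Notation "x %:C" := (real_complex_def (Phant _) x) (format "x %:C").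

(** * Convergence of complex series *)

Section ComplexLimits.
Variable R : realType.
Local Notation C := (Cplx R).
Implicit Types (z w : C) (x y : R).

Lemma normE z : `|z| = (Num.sqrt (re z ^+ 2 + im z ^+ 2))%:C.
Proof. exact: normc_def. Qed.

Lemma norm_le_ReIm z : `|z| <= (`|re z| + `|im z|)%:C.
Proof.
rewrite normE lecR -(ler_sqr (sqrtr_ge0 _)) ?nnegrE ?addr_ge0//.
  rewrite sqr_sqrtr ?addr_ge0 ?sqr_ge0// sqrrD !real_normK ?num_real//.
  by rewrite -addrA lerD2l lerDr mulrn_wge0 ?mulr_ge0.
Qed.

Lemma norm_Re_le z : `|re z|%:C <= `|z|.
Proof. exact: normc_ge_Re. Qed.

Lemma norm_Im_le z : `|im z|%:C <= `|z|.
Proof.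
rewrite normE lecR -(ler_sqr _ (sqrtr_ge0 _)) ?nnegrE ?normr_ge0//.
by rewrite sqr_sqrtr ?addr_ge0 ?sqr_ge0// real_normK ?num_real// lerDr sqr_ge0.
Qed.

Section Filter.
Context {T : Type} {F : set_system T} {FF : Filter F}.

Lemma cvg_ReIm (f : T -> C) (l : C) :
  re (f t) @[t --> F] --> re l -> im (f t) @[t --> F] --> im l ->
  f t @[t --> F] --> l.
Proof.
move=> fr fi; apply/cvgrPdist_lt => e e0.
have er : e = (re e)%:C by rewrite RRe_real// gtr0_real.
have re0 : 0 < re e / 2 by rewrite divr_gt0// -ltcR -er.
move/cvgrPdist_lt: fr => /(_ _ re0) fr.
move/cvgrPdist_lt: fi => /(_ _ re0) fi.
near=> t.
apply: (le_lt_trans (norm_le_ReIm _)); rewrite er ltcR.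
rewrite [ltRHS](splitr (re e)) ltrD//.
  have -> : re (l - f t) = re l - re (f t) by case: (l) (f t) => ? ? [].
  by near: t.
have -> : im (l - f t) = im l - im (f t) by case: (l) (f t) => ? ? [].
by near: t.
Unshelve. all: by end_near. Qed.

Lemma cvg_Re (f : T -> C) (l : C) :
  f t @[t --> F] --> l -> re (f t) @[t --> F] --> re l.
Proof.
move=> /cvgrPdist_lt fl; apply/cvgrPdist_lt => e e0.
have /fl : 0 < e%:C :> C by rewrite ltcR.
apply: filterS => t; rewrite -ltcR; apply: le_lt_trans.
suff -> : re l - re (f t) = re (l - f t) by exact: norm_Re_le.
by case: (l) (f t) => ? ? [].
Qed.

Lemma cvg_Im (f : T -> C) (l : C) :
  f t @[t --> F] --> l -> im (f t) @[t --> F] --> im l.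
Proof.
move=> /cvgrPdist_lt fl; apply/cvgrPdist_lt => e e0.
have /fl : 0 < e%:C :> C by rewrite ltcR.
apply: filterS => t; rewrite -ltcR; apply: le_lt_trans.
suff -> : im l - im (f t) = im (l - f t) by exact: norm_Im_le.
by case: (l) (f t) => ? ? [].
Qed.

End Filter.

Lemma ReD z w : re (z + w) = re z + re w. Proof. by case: z; case: w. Qed.
Lemma ImD z w : im (z + w) = im z + im w. Proof. by case: z; case: w. Qed.

Lemma Re_series (f : nat -> C) n : re (series f n) = series (re \o f) n.
Proof.
by rewrite !seriesEnat/=; elim/big_rec2: _ => // i x y _ <-; rewrite ReD.
Qed.

Lemma Im_series (f : nat -> C) n : im (series f n) = series (im \o f) n.
Proof.
by rewrite !seriesEnat/=; elim/big_rec2: _ => // i x y _ <-; rewrite ImD.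
Qed.

(** * Dominated convergence for real series *)

Section RealTannery.
Variable g : nat -> R.
Hypothesis cg : cvgn (series g).

Lemma dominated_cvg_series (u : nat -> R) :
  (forall k, `|u k| <= g k) -> cvgn (series u).
Proof.
move=> ug; apply: normed_cvg; apply: (series_le_cvg _ _ _ cg) => //= k.
by apply: le_trans (ug k).
Qed.

(** The bound involves [g] alone, so it is uniform over the dominated family; it comes from the
    bound on finite blocks in the limit. *)
Lemma dominated_series_tail (u : nat -> R) N :
  (forall k, `|u k| <= g k) ->
  `|limn (series u) - series u N| <= limn (series g) - series g N.
Proof.
move=> ug; have cu := dominated_cvg_series ug.
have cN (v : nat -> R) : cvgn (series v) ->
    series v n - series v N @[n --> \oo] --> limn (series v) - series v N.
  by move=> cv; apply: cvgB => //; exact: cvg_cst.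
have cuN : `|series u n - series u N| @[n --> \oo] --> `|limn (series u) - series u N|.
  exact: cvg_norm (cN _ cu).
rewrite -(cvg_lim (@Rhausdorff R) cuN) -(cvg_lim (@Rhausdorff R) (cN _ cg)).
apply: ler_lim; [by apply/cvg_ex; eexists; exact: cuN| by apply/cvg_ex; eexists; exact: cN |].
near=> n; have Nn : (N <= n)%N by near: n; exact: nbhs_infty_ge.
rewrite !sub_series_geq//; apply: le_trans (ler_norm_sum _ _ _) _.
by apply: ler_sum.
Unshelve. all: by end_near. Qed.

(** Cut at an [N] where the tail of [g] is small, then let finitely many terms converge. The
    domination of [l] is returned too: the complex version uses it to sum [l]. *)
Lemma tannery_real {T : Type} {F : set_system T} {FF : ProperFilter F}
    (u : T -> nat -> R) (l : nat -> R) :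
  (forall k, u t k @[t --> F] --> l k) ->
  (\forall t \near F, forall k, `|u t k| <= g k) ->
  (forall k, `|l k| <= g k) /\
  limn (series (u t)) @[t --> F] --> limn (series l).
Proof.
move=> ul ug.
have lg k : `|l k| <= g k.
  have c : `|u t k| @[t --> F] --> `|l k| by exact: cvg_norm (ul k).
   rewrite -(cvg_lim (@Rhausdorff R) c).
  apply: limr_le; first by apply/cvg_ex; eexists; exact: c.
  by apply: filterS ug => t; exact.
split=> //; apply/cvgrPdist_lt => e e0.
have e3 : 0 < e / 3 by rewrite divr_gt0.
have /cvgrPdist_lt/(_ _ e3) [N _ hN] := cg.
have {}hN : limn (series g) - series g N < e / 3.
  by apply: le_lt_trans (ler_norm _) _; apply: (hN N) => /=.
have cN : series (u t) N @[t --> F] --> series l N.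
  rewrite seriesEnat /= (_ : (fun t => _) = fun t => \sum_(0 <= k < N) u t k).
    by apply: cvg_big => //; exact: add_continuous.
  by apply/funext => t; rewrite seriesEnat.
move/cvgrPdist_lt: cN => /(_ _ e3) cN.
near=> t.
have ht : forall k, `|u t k| <= g k by near: t.
have h1 := dominated_series_tail N ht.
have h2 := dominated_series_tail N lg.
have h3 : `|series l N - series (u t) N| < e / 3 by near: t.
have -> : limn (series l) - limn (series (u t)) =
  (limn (series l) - series l N) + (series l N - series (u t) N)
  - (limn (series (u t)) - series (u t) N) by ring.
apply: le_lt_trans (ler_normB _ _) _.
apply: le_lt_trans (lerD (ler_normD _ _) (lexx _)) _.
lra.
Unshelve. all: by end_near. Qed.

End RealTannery.

Lemma lim_series_ReIm (f : nat -> C) :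
  cvgn (series (re \o f)) -> cvgn (series (im \o f)) ->
  cvgn (series f) /\
  limn (series f) = Complex (limn (series (re \o f))) (limn (series (im \o f))).
Proof.
move=> cr ci.
suff h : series f @ \oo -->
    (Complex (limn (series (re \o f))) (limn (series (im \o f))) : C).
  split; first by apply/cvg_ex; eexists; exact: h.
  exact: norm_cvg_lim h.
apply: cvg_ReIm => /=.
  by rewrite (funext (Re_series f)).
by rewrite (funext (Im_series f)).
Qed.

Lemma Re_dominated z x : `|z| <= x%:C -> `|re z| <= x.
Proof. by move=> h; rewrite -lecR; apply: le_trans h; exact: norm_Re_le. Qed.

Lemma Im_dominated z x : `|z| <= x%:C -> `|im z| <= x.
Proof. by move=> h; rewrite -lecR; apply: le_trans h; exact: norm_Im_le. Qed.

(** * Dominated convergence for complex series *)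

Section ComplexTannery.
Variable g : nat -> R.
Hypothesis cg : cvgn (series g).

Lemma dominated_cvg_cseries (u : nat -> C) :
  (forall k, `|u k| <= (g k)%:C) -> cvgn (series u).
Proof.
move=> ug; apply: (lim_series_ReIm _ _).1; apply: dominated_cvg_series cg _ _.
  by move=> k; exact: Re_dominated.
by move=> k; exact: Im_dominated.
Qed.

Lemma tannery {T : Type} {F : set_system T} {FF : ProperFilter F}
    (u : T -> nat -> C) (l : nat -> C) :
  (forall k, u t k @[t --> F] --> l k) ->
  (\forall t \near F, forall k, `|u t k| <= (g k)%:C) ->
  limn (series (u t)) @[t --> F] --> limn (series l).
Proof.
move=> ul ug.
have [lr hr] := @tannery_real g cg _ _ _ (fun t => re \o u t) (re \o l)
  (fun k => cvg_Re (ul k)) (filterS (fun t h k => Re_dominated (h k)) ug).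
have [li hi] := @tannery_real g cg _ _ _ (fun t => im \o u t) (im \o l)
  (fun k => cvg_Im (ul k)) (filterS (fun t h k => Im_dominated (h k)) ug).
have [_ ->] := lim_series_ReIm (dominated_cvg_series cg lr)
                               (dominated_cvg_series cg li).
have E : {near F, (fun t => Complex (limn (series (re \o u t)))
    (limn (series (im \o u t))) : C) =1 (fun t => limn (series (u t)))}.
  apply: filterS ug => t h; apply/esym.
  by apply: (lim_series_ReIm _ _).2; apply: dominated_cvg_series cg _ _ => k;
    [exact: Re_dominated (h k) | exact: Im_dominated (h k)].
apply: (cvg_trans (near_eq_cvg E)).
exact: cvg_ReIm.
Qed.

End ComplexTannery.

(** A geometric majorant serving both halves of a two-sided series; Gaussian decay of theta terms
    supplies [K] uniformly in [tau]. *)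
Definition exp_dominated (K : R) (f : int -> C) :=
  forall m, `|f m| <= (K * expR (- (`|m|%N)%:R))%:C.

Lemma cvg_series_expR (K : R) : cvgn (series (fun k => K * expR (- k%:R))).
Proof.
have -> : (fun k => K * expR (- k%:R)) = geometric K (expR (-1) : R).
  by apply/funext => k /=; rewrite -mulN1r expRM_natr.
by apply: is_cvg_geometric_series; rewrite ger0_norm ?expR_ge0// expR_lt1; lra.
Qed.

Arguments cvg_series_expR : clear implicits.

Lemma exp_dominated_Posz K f : exp_dominated K f ->
  forall k, `|f (Posz k)| <= (K * expR (- k%:R))%:C.
Proof. by move=> h k; apply: h. Qed.

Lemma exp_dominated_ge0 K f : exp_dominated K f -> 0 <= K.
Proof.
move=> /(_ 0); rewrite absz0 oppr0 expR0 mulr1 => h.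
by rewrite -lecR; apply: le_trans (normr_ge0 _) h.
Qed.

(** [Negz k] is -(k+1), so a factor exp(-1) is given away; this takes K >= 0, read off at m = 0. *)
Lemma exp_dominated_Negz K f : exp_dominated K f ->
  forall k, `|f (Negz k)| <= (K * expR (- k%:R))%:C.
Proof.
move=> h k; apply: le_trans (h _) _; rewrite lecR ler_wpM2l//.
  exact: exp_dominated_ge0 h.
by rewrite ler_expR lerN2 ler_nat /=.
Qed.

Lemma tannery_sumZ {T : Type} {F : set_system T} {FF : ProperFilter F}
    (u : T -> int -> C) (l : int -> C) (K : R) :
  (forall m, u t m @[t --> F] --> l m) ->
  (\forall t \near F, exp_dominated K (u t)) ->
  sumZ (u t) @[t --> F] --> sumZ l.
Proof.
move=> ul ug; apply: cvgD.
  apply: (@tannery _ (cvg_series_expR K) T F FF (fun t k => u t (Posz k)) (fun k => l (Posz k)));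
    first by move=> k; exact: ul.
  by apply: filterS ug => t; exact: exp_dominated_Posz.
apply: (@tannery _ (cvg_series_expR K) T F FF (fun t k => u t (Negz k)) (fun k => l (Negz k)));
  first by move=> k; exact: ul.
by apply: filterS ug => t; exact: exp_dominated_Negz.
Qed.

Lemma sumZB K K' (f g : int -> C) : exp_dominated K f -> exp_dominated K' g ->
  sumZ f - sumZ g = sumZ (fun m => f m - g m).
Proof.
move=> hf hg; rewrite /sumZ.
have cP k h : exp_dominated k h -> cvgn (series (fun n => h (Posz n))).
  by move=> /exp_dominated_Posz; exact: dominated_cvg_cseries (cvg_series_expR k) _.
have cN k h : exp_dominated k h -> cvgn (series (fun n => h (Negz n))).
  by move=> /exp_dominated_Negz; exact: dominated_cvg_cseries (cvg_series_expR k) _.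
rewrite -[fun k => f (Posz k) - _]/((fun k => f (Posz k)) - (fun k => g (Posz k))).
rewrite -[fun k => f (Negz k) - _]/((fun k => f (Negz k)) - (fun k => g (Negz k))).
rewrite (lim_seriesB (cP _ _ hf) (cP _ _ hg)) (lim_seriesB (cN _ _ hf) (cN _ _ hg)).
by rewrite opprD addrACA.
Qed.

Lemma exp_dominatedB K K' (f g : int -> C) : exp_dominated K f ->
  exp_dominated K' g -> exp_dominated (K + K') (fun m => f m - g m).
Proof.
move=> hf hg m; apply: le_trans (ler_normB _ _) _.
by rewrite mulrDl rmorphD lerD.
Qed.

Lemma sumZZ K (f : int -> C) (c : C) : exp_dominated K f ->
  c * sumZ f = sumZ (fun m => c * f m).
Proof.
move=> hf; rewrite /sumZ.
have cP : cvgn (series (fun k => f (Posz k))).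
  by move: hf => /exp_dominated_Posz; exact: dominated_cvg_cseries (cvg_series_expR K) _.
have cN : cvgn (series (fun k => f (Negz k))).
  by move: hf => /exp_dominated_Negz; exact: dominated_cvg_cseries (cvg_series_expR K) _.
rewrite mulrDr; congr (_ + _); apply/esym.
  exact: (lim_seriesZ c cP).
exact: (lim_seriesZ c cN).
Qed.

(** The indices 0 and -1 open the two halves, and are the only ones at which the theta series below
    can attain their least exponent. *)
Lemma sumZ_finite (f : int -> C) :
  (forall m, m != 0 -> m != -1 -> f m = 0) -> sumZ f = f 0 + f (-1).
Proof.
move=> f0; rewrite /sumZ.
have H (u : nat -> C) : (forall k, u k.+1 = 0) -> limn (series u) = u 0%N.
  move=> u0; apply: norm_cvg_lim; apply: cvg_near_cst.
  near=> n; have : (0 < n)%N by near: n; exact: nbhs_infty_gt.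
  move=> n0; rewrite -(prednK n0) seriesEnat /= big_nat_recl// big1 ?addr0// => i _.
by congr (_ + _); apply: H => k; apply: f0.
Unshelve. all: by end_near. Qed.

End ComplexLimits.

(** * The complex exponential *)

Section ComplexExponential.
Variable R : realType.
Local Notation C := (Cplx R).
Implicit Types (z w h : C) (x y r : R).

Lemma cexpD z w : cexp (z + w) = cexp z * cexp w.
Proof.
case: z w => [a b] [c d]; apply/eqP; rewrite eq_complex /= expRD cosD sinD.
by apply/andP; split; apply/eqP; ring.
Qed.

Lemma cexp0 : cexp 0 = 1 :> C.
Proof. by rewrite /cexp /= expR0 cos0 sin0 !mul1r. Qed.

Lemma cexpxN z : cexp z * cexp (- z) = 1.
Proof. by rewrite -cexpD subrr cexp0. Qed.

Lemma cexp_neq0 z : cexp z != 0.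
Proof.
by apply/eqP => z0; have /eqP := cexpxN z; rewrite z0 mul0r eq_sym oner_eq0.
Qed.

Lemma cexpN z : cexp (- z) = (cexp z)^-1.
Proof. by apply: (mulfI (cexp_neq0 z)); rewrite cexpxN mulfV// cexp_neq0. Qed.

Lemma cexpMn z n : cexp (n%:R * z) = cexp z ^+ n.
Proof.
elim: n => [|n IH]; first by rewrite mul0r cexp0 expr0.
by rewrite -natr1 mulrDl mul1r cexpD IH exprSr.
Qed.

Lemma cexpMz z (m : int) : cexp (m%:~R * z) = cexp z ^ m.
Proof.
case: m => n; first by rewrite -pmulrn cexpMn.
by rewrite NegzE mulrNz mulNr cexpN -pmulrn cexpMn.
Qed.

Lemma norm_cexp z : `|cexp z| = (expR (re z))%:C.
Proof.
rewrite normE /=; congr _%:C.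
by rewrite !exprMn -mulrDr cos2Dsin2 mulr1 sqrtr_sqr ger0_norm ?expR_ge0.
Qed.

(** Mean value theorem on [0, |y|], first for sin and cos, then for sin t - t; parity covers y <
    0. *)
Lemma sin_cos_bound y : [/\ `|sin y| <= `|y|, `|cos y - 1| <= `|y|,
  `|cos y - 1| <= y ^+ 2 & `|sin y - y| <= y ^+ 2].
Proof.
suff H (x : R) : 0 <= x -> [/\ `|sin x| <= x, `|cos x - 1| <= x,
    `|cos x - 1| <= x ^+ 2 & `|sin x - x| <= x ^+ 2].
  have [y0|y0] := leP 0 y; first by rewrite (ger0_norm y0); exact: H.
  have := H (- y); rewrite cosN sinN sqrrN (ltr0_norm y0) normrN -opprD normrN.
  by apply; rewrite oppr_ge0 ltW.
have S (t : R) : 0 <= t -> `|sin t| <= t.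
  move=> t0; have [] := @MVT_segment R sin cos 0 t t0 (fun x _ => is_derive_sin x).
    exact/continuous_subspaceT/continuous_sin.
  move=> c _; rewrite sin0 !subr0 => ->.
  by rewrite normrM (ger0_norm t0) ler_piMl// cos_max.
have K (t : R) : 0 <= t -> exists2 c, 0 <= c <= t & `|cos t - 1| = `|sin c| * t.
  move=> t0.
  have [] := @MVT_segment R cos (- sin) 0 t t0 (fun x _ => is_derive_cos x).
    exact/continuous_subspaceT/continuous_cos.
  move=> c; rewrite in_itv/= cos0 subr0 => ct ->; exists c => //.
  by rewrite normrM normrN (ger0_norm t0).
have K1 (t : R) : 0 <= t -> `|cos t - 1| <= t.
  by move=> t0; have [c _ ->] := K t t0; rewrite ler_piMl// sin_max.
move=> x0; split; [exact: S|exact: K1| |].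
  have [c /andP[c0 cx] ->] := K x x0; rewrite expr2 ler_wpM2r//.
  exact: le_trans (S _ c0) cx.
have D (t : R) : t \in `]0, x[ ->
    is_derive t 1 (fun t => sin t - t) (cos t - 1).
  by move=> _; exact: (is_deriveB (is_derive_sin t) (is_derive_id t 1)).
have [|c] := MVT_segment x0 D.
  apply/continuous_subspaceT => t; apply: cvgB; last exact: cvg_id.
  exact: continuous_sin.
rewrite in_itv/= sin0 !subr0 => /andP[c0 cx] ->.
rewrite normrM (ger0_norm x0) expr2 ler_wpM2r//.
exact: le_trans (K1 _ c0) cx.
Qed.

(** Everything follows from 1 + x <= exp x, applied at x and at -x. *)
Lemma expR_bound x : `|expR x - 1| <= `|x| * expR `|x| /\
  `|expR x - 1 - x| <= `|x| ^+ 2 * expR `|x|.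
Proof.
have h1 := expR_ge1Dx x.
have h2 : expR x - 1 <= x * expR x.
  have := expR_ge1Dx (- x); rewrite expRN => h.
  have e0 := expR_gt0 x.
  have : (1 - x) * expR x <= 1 by rewrite -ler_pdivlMr// mul1r.
  lra.
have h3 : `|expR x - 1| <= `|x| * expR `|x|.
  have [x0|x0] := leP 0 x.
    by rewrite (ger0_norm x0) ger0_norm; lra.
  have : 1 <= expR (- x) by rewrite -expR0 ler_expR; lra.
  rewrite (ltr0_norm x0) ler0_norm; last by nra.
  by nra.
split=> //.
rewrite ger0_norm; last lra.
apply: (@le_trans _ _ (x * (expR x - 1))); first by lra.
apply: le_trans (ler_norm _) _.
by rewrite normrM expr2 -mulrA ler_wpM2l.
Qed.

(** The constants 3 and 4 count the pieces into which the real and imaginary parts are split, each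
    bounded by r exp(r) or r^2 exp(r). *)
Lemma cexp_bound w r : `|w| <= r%:C ->
  `|cexp w - 1| <= (3 * r * expR r)%:C /\
  `|cexp w - 1 - w| <= (4 * r ^+ 2 * expR r)%:C.
Proof.
move=> wr; have := Im_dominated wr; have := Re_dominated wr.
case: w {wr} => x y /= xr yr.
have r0 : 0 <= r by apply: le_trans xr.
have [ex1 ex2] := expR_bound x.
have [s1 c1 c2 s2] := sin_cos_bound y.
have er : expR x <= expR r by rewrite ler_expR (le_trans (ler_norm _) xr).
have exr : expR `|x| <= expR r by rewrite ler_expR.
have er1 : 1 <= expR r by rewrite -expR0 ler_expR.
have yr2 : y ^+ 2 <= r ^+ 2 by rewrite -(real_normK (num_real y)) lerXn2r ?nnegrE.
have xr2 : `|x| ^+ 2 <= r ^+ 2 by rewrite lerXn2r ?nnegrE.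
have rE0 : 0 <= r * expR r by rewrite mulr_ge0// expR_ge0.
have a1 : `|expR x - 1| <= r * expR r.
  by apply: le_trans ex1 _; rewrite ler_pM// ?expR_ge0.
have a2 : `|expR x - 1 - x| <= r ^+ 2 * expR r.
  by apply: le_trans ex2 _; rewrite ler_pM// ?expR_ge0.
have a3 : `|expR x * (cos y - 1)| <= r * expR r.
  by rewrite normrM ger0_norm ?expR_ge0// mulrC ler_pM ?expR_ge0// (le_trans c1).
have a4 : `|expR x * (cos y - 1)| <= r ^+ 2 * expR r.
  by rewrite normrM ger0_norm ?expR_ge0// mulrC ler_pM ?expR_ge0// (le_trans c2).
have a5 : `|expR x * sin y| <= r * expR r.
  by rewrite normrM ger0_norm ?expR_ge0// mulrC ler_pM ?expR_ge0// (le_trans s1).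
have a6 : `|(expR x - 1) * sin y| <= r ^+ 2 * expR r.
  rewrite normrM; apply: le_trans (ler_pM _ _ a1 (le_trans s1 yr)) _ => //.
  by rewrite expr2; lra.
have a7 : `|sin y - y| <= r ^+ 2 * expR r.
  by apply: le_trans s2 _; apply: le_trans yr2 _; rewrite ler_peMr// sqr_ge0.
split; apply: le_trans (norm_le_ReIm _) _; rewrite lecR /=.
  have -> : expR x * cos y - 1 = expR x * (cos y - 1) + (expR x - 1) by ring.
  have := ler_normD (expR x * (cos y - 1)) (expR x - 1).
  rewrite oppr0 addr0; lra.
have -> : expR x * cos y - 1 - x = expR x * (cos y - 1) + (expR x - 1 - x) by ring.
have -> : expR x * sin y - 0 - y = (expR x - 1) * sin y + (sin y - y) by ring.
have := ler_normD (expR x * (cos y - 1)) (expR x - 1 - x).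
have := ler_normD ((expR x - 1) * sin y) (sin y - y).
lra.
Qed.

Lemma cexp_quotient_cvg z :
  h^-1 * (cexp (z * h) - 1) @[h --> (0 : C)^'] --> z.
Proof.
have [E0 Ez] : 0 <= re `|z| /\ `|z| = (re `|z|)%:C.
  by rewrite normE /= sqrtr_ge0.
set r := re `|z| in E0 Ez.
set K : R := 4 * r ^+ 2 * expR r.
have K0 : 0 <= K by rewrite !mulr_ge0 ?sqr_ge0 ?expR_ge0.
apply/cvgrPdist_le => e e0.
have er : e = (re e)%:C by rewrite RRe_real// gtr0_real.
have ep : 0 < re e by rewrite -ltcR -er.
near=> h.
have h0 : h != 0 by near: h; exact: nbhs_dnbhs_neq.
have h1 : `|h| <= 1.
  near: h; apply: dnbhs0_le; exact: ltr01.
(* The error is at most K |h|; the denominator K + 1 covers z = 0, where K = 0. *)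
have h2 : `|h| <= (re e / (K + 1))%:C.
  by near: h; apply: dnbhs0_le; rewrite ltcR divr_gt0//; lra.
have Eh : `|h| = (re `|h|)%:C by rewrite normE.
set s := re `|h| in Eh.
have s0 : 0 < s by rewrite -ltcR -Eh normr_gt0.
have s1 : s <= 1 by rewrite -lecR -Eh.
have s2 : s <= re e / (K + 1) by rewrite -lecR -Eh.
have zh : `|z * h| <= (r * s)%:C by rewrite normrM Ez Eh -rmorphM.
have [_ b] := cexp_bound zh.
have -> : z - h^-1 * (cexp (z * h) - 1) = - (h^-1 * (cexp (z * h) - 1 - z * h)).
  by field.
rewrite normrN normrM normfV Eh er.
rewrite -ler_pdivlMl ?invr_gt0 ?ltcR// invrK.
apply: le_trans b _; rewrite -rmorphM lecR.
have : expR (r * s) <= expR r by rewrite ler_expR ler_piMr.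
have := expR_gt0 (r * s).
move=> E1 E2.
apply: (@le_trans _ _ (K * s * s)).
  rewrite exprMn /K.
  have : 0 <= r ^+ 2 * s ^+ 2 by rewrite mulr_ge0 ?sqr_ge0.
  move=> X; rewrite !expr2 in X *.
  have := ler_wpM2l X E2; lra.
rewrite [leRHS]mulrC ler_wpM2r ?(ltW s0)//.
move: s2; rewrite ler_pdivlMr; last lra.
by rewrite mulrDr mulr1 mulrC; lra.
Unshelve. all: by end_near. Qed.

End ComplexExponential.

(** * Theta series as Im tau tends to infinity *)

Section ThetaLimits.
Variable R : realType.
Local Notation C := (Cplx R).
Implicit Types (z w h b tau : C) (x y a e W D : R).

Lemma im_pinfty_ge x : \forall tau \near im_pinfty R, x <= im tau.
Proof. by exists x => // tau /ltW. Qed.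

(** Transfers limits to the modulus n tau, at which the thetas of [belavin_R] and [psiE] are
    taken. *)
Lemma im_pinfty_natM (n : nat) : (0 < n)%N ->
  (n%:R * tau : C) @[tau --> im_pinfty R] `=>` im_pinfty R.
Proof.
(* For M < 0 the bound Im tau > M would not give n Im tau > M, hence the absolute value. *)
move=> n0 A [M _ MA]; exists (`|M|) => // tau /= Mt; apply: MA => /=.
have -> : im (n%:R * tau) = n%:R * im tau.
  have -> : (n%:R : C) = (n%:R)%:C by rewrite rmorph_nat.
  by case: (tau) => u v /=; rewrite mul0r addr0.
have n1 : 1 <= n%:R :> R by rewrite ler1n.
have := ler_norm M; have := normr_ge0 M; nra.
Qed.

Lemma re_phase x y tau z :
  re (cpi R * imunit R * x%:C * tau + 2 * cpi R * imunit R * y%:C * z) =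
  - (pi * x * im tau) - 2 * pi * y * im z.
Proof.
have -> : (2 : C) = (2 : R)%:C by rewrite rmorph_nat.
by case: tau z => [u v] [p q] /=; ring.
Qed.

Lemma re_nome x tau : re (cpi R * imunit R * x%:C * tau) = - (pi * x * im tau).
Proof. by case: tau => [u v] /=; ring. Qed.

Lemma nome_cvg0 x : 0 < x ->
  cexp (cpi R * imunit R * x%:C * tau) @[tau --> im_pinfty R] --> (0 : C).
Proof.
move=> x0; apply/cvgrPdist_le => e e0.
have er : e = (re e)%:C by rewrite RRe_real// gtr0_real.
have ep : 0 < re e by rewrite -ltcR -er.
near=> tau; rewrite sub0r normrN norm_cexp er lecR.
have px : 0 < pi * x by rewrite mulr_gt0 ?pi_gt0.
rewrite -[leRHS]lnK ?posrE// ler_expR re_nome lerNl -ler_pdivrMl//.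
near: tau; exact: im_pinfty_ge.
Unshelve. all: by end_near. Qed.

(** With pi >= 1 and t >= 1 it suffices that x^2 - (B+1)|x| >= -(B+1)^2, by completing the square;
    the bound is free of t. *)
Lemma gauss_bound x e B t : 0 <= B -> e <= x ^+ 2 -> 1 <= t ->
  - (pi * (x ^+ 2 - e) * t) + B * `|x| <= e + (B + 1) ^+ 2 - `|x|.
Proof.
move=> B0 ex t1.
have p1 : 1 <= pi :> R by have := pi_ge2 R; lra.
have n2 : `|x| ^+ 2 = x ^+ 2 by rewrite real_normK ?num_real.
have h1 : x ^+ 2 - e <= pi * (x ^+ 2 - e) by rewrite ler_peMl; lra.
have h2 : pi * (x ^+ 2 - e) <= pi * (x ^+ 2 - e) * t by rewrite ler_peMr; lra.
have h3 : 0 <= (`|x| - (B + 1) / 2) ^+ 2 by exact: sqr_ge0.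
nra.
Qed.

Lemma intrC_real (m : int) a : m%:~R + a%:C = (m%:~R + a)%:C :> C.
Proof. by rewrite rmorphD rmorph_int. Qed.

Definition theta_term a b tau z (m : int) : C :=
  cexp (cpi R * imunit R * (m%:~R + a%:C) ^+ 2 * tau
        + 2 * cpi R * imunit R * (m%:~R + a%:C) * (z + b)).

Lemma theta_charE a b tau z : theta_char a%:C b tau z = sumZ (theta_term a b tau z).
Proof. by []. Qed.

Lemma theta_termE a b tau z m : theta_term a b tau z m =
  cexp (cpi R * imunit R * ((m%:~R + a) ^+ 2)%:C * tau
        + 2 * cpi R * imunit R * (m%:~R + a)%:C * (z + b)).
Proof. by rewrite /theta_term intrC_real rmorphXn. Qed.

(** [K] is chosen before [tau] and the weights [c]. Weights of exponential growth cover derivatives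
    and difference quotients; together with Im (z + b) they enter the linear rate [B], which the
    Gaussian absorbs. *)
Lemma theta_dominated a e b z W D : (forall m : int, e <= (m%:~R + a) ^+ 2) ->
  0 <= W -> exists K, forall tau (c : int -> C), 1 <= im tau ->
  (forall m, `|c m| <= (D * expR (W * `|m%:~R + a|))%:C) ->
  exp_dominated K (fun m => cexp (- (cpi R * imunit R * e%:C * tau)) *
                            (c m * theta_term a b tau z m)).
Proof.
move=> ea W0; set B := W + 2 * pi * `|im (z + b)|.
have p0 := pi_ge0 R.
have B0 : 0 <= B by rewrite addr_ge0 ?mulr_ge0.
exists (`|D| * expR (e + (B + 1) ^+ 2 + `|a|)) => tau c t1 cm m.
set x := m%:~R + a.
rewrite mulrCA normrM theta_termE -/x -cexpD norm_cexp.
have -> : - (cpi R * imunit R * e%:C * tau) +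
    (cpi R * imunit R * (x ^+ 2)%:C * tau + 2 * cpi R * imunit R * x%:C * (z + b)) =
    cpi R * imunit R * (x ^+ 2 - e)%:C * tau + 2 * cpi R * imunit R * x%:C * (z + b).
  by rewrite rmorphB /=; ring.
apply: le_trans (ler_wpM2r _ (cm m)) _; first by rewrite ler0c expR_ge0.
rewrite -rmorphM lecR re_phase -/x -!mulrA -!expRD.
apply: (@le_trans _ _ (`|D| * expR (W * `|x| +
    (- (pi * ((x ^+ 2 - e) * im tau)) - 2 * (pi * (x * im (z + b))))))).
  by rewrite ler_wpM2r ?expR_ge0 ?ler_norm.
rewrite ler_wpM2l// ler_expR.
have g := gauss_bound B0 (ea m) t1; rewrite -/x in g.
have h : - (2 * (pi * (x * im (z + b)))) <= 2 * pi * `|im (z + b)| * `|x|.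
  apply: le_trans (ler_norm _) _.
  by rewrite normrN !normrM (ger0_norm p0) ger0_norm// le_eqVlt; apply/orP; left; apply/eqP; ring.
(* Decay in |m + a| becomes decay in |m| at the cost of exp(|a|) in [K]. *)
have hm : (`|m|%N)%:R <= `|x| + `|a|.
  have := ler_normB x a; rewrite /x addrK => /(le_trans _); apply.
  by rewrite natr_absz intr_norm.
rewrite /B in g *; lra.
Qed.

(** After normalisation term m carries the exponent (m+a)^2 - e >= 0: it is constant in [tau] if
    this is 0 and tends to 0 otherwise. *)
Lemma weighted_theta_cvg a e b z W D (c : int -> C) :
  (forall m : int, e <= (m%:~R + a) ^+ 2) -> 0 <= e -> 0 <= W ->
  (forall m, `|c m| <= (D * expR (W * `|m%:~R + a|))%:C) ->
  cexp (- (cpi R * imunit R * e%:C * tau)) *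
    sumZ (fun m => c m * theta_term a b tau z m) @[tau --> im_pinfty R] -->
  sumZ (fun m => if (m%:~R + a) ^+ 2 == e then
                   c m * cexp (2 * cpi R * imunit R * (m%:~R + a)%:C * (z + b))
                 else 0).
Proof.
move=> ea e0 W0 cm.
have [K hK] := theta_dominated b z D ea W0.
have ea0 (m : int) : 0 <= (m%:~R + a) ^+ 2 by rewrite sqr_ge0.
(* The instance e = 0 makes the unnormalised series converge, so the prefactor may move inside the
   sum. *)
have [K0 hK0] := theta_dominated b z D ea0 W0.
have E : {near im_pinfty R, (fun tau => sumZ (fun m => cexp (- (cpi R * imunit R * e%:C * tau)) *
                            (c m * theta_term a b tau z m))) =1
  (fun tau => cexp (- (cpi R * imunit R * e%:C * tau)) *
    sumZ (fun m => c m * theta_term a b tau z m))}.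
  near=> tau; apply/esym/sumZZ => m.
  have t1 : 1 <= im tau by near: tau; exact: im_pinfty_ge.
  have := hK0 tau c t1 cm m.
  by rewrite mulr0 mul0r oppr0 cexp0 mul1r; apply.
apply: (cvg_trans (near_eq_cvg E)); apply: (@tannery_sumZ _ _ _ _ _ _ K).
  move=> m; set x := m%:~R + a.
  have T tau : cexp (- (cpi R * imunit R * e%:C * tau)) * (c m * theta_term a b tau z m)
      = cexp (cpi R * imunit R * (x ^+ 2 - e)%:C * tau) *
        (c m * cexp (2 * cpi R * imunit R * x%:C * (z + b))).
    rewrite theta_termE -/x mulrCA -cexpD [RHS]mulrCA -cexpD; congr (_ * cexp _).
    by rewrite rmorphB /=; ring.
  rewrite (funext T).
  have [xe|xe] := eqVneq (x ^+ 2) e.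
    rewrite xe subrr.
    rewrite (_ : (fun=> _) = fun=> c m * cexp (2 * cpi R * imunit R * x%:C * (z + b)));
      first exact: cvg_cst.
    by apply/funext => tau; rewrite mulr0 mul0r cexp0 mul1r.
  rewrite -[X in _ --> X](mul0r (c m * cexp (2 * cpi R * imunit R * x%:C * (z + b)))).
  apply: cvgMr_tmp; apply: nome_cvg0.
  by rewrite subr_gt0 lt_neqAle eq_sym xe ea.
near=> tau; apply: hK => //; near: tau; exact: im_pinfty_ge.
Unshelve. all: by end_near. Qed.

End ThetaLimits.

(** * Termwise differentiation of theta series *)

Section ThetaDerivative.
Variable R : realType.
Local Notation C := (Cplx R).
Implicit Types (z w h b tau : C) (x y a e W D : R).

(** The factor that d/dz brings down from term m. *)
Definition freq a (m : int) : C := 2 * cpi R * imunit R * (m%:~R + a)%:C.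

Lemma norm_freq a m : `|freq a m| = (2 * pi * `|m%:~R + a|)%:C.
Proof.
rewrite /freq -[2 * _ * _ * _]mulrA -(rmorph_nat (real_complex R)).
rewrite (_ : imunit R * (m%:~R + a)%:C = Complex 0 (m%:~R + a)); last first.
  by apply/eqP; rewrite eq_complex /=; apply/andP; split; apply/eqP; ring.
rewrite /cpi -rmorphM normrM !normE /= expr0n /= addr0 add0r.
by rewrite !sqrtr_sqr -rmorphM ger0_norm// mulr_ge0 ?pi_ge0.
Qed.

(** With y = |freq a m|, the first-order remainder gives 3 y exp(y |h|) <= 3 exp(2y), as y <= exp y;
    hence the rate 4 pi, twice 2 pi. *)
Lemma freq_quotient_bound a (m : int) h : h != 0 -> `|h| <= 1 ->
  `|h^-1 * (cexp (freq a m * h) - 1)| <=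
    (3 * expR (4 * pi * `|m%:~R + a|))%:C.
Proof.
move=> h0 h1; set x := m%:~R + a; set y := 2 * pi * `|x|.
have y0 : 0 <= y by rewrite !mulr_ge0 ?pi_ge0.
have Eh : `|h| = (re `|h|)%:C by rewrite normE.
set s := re `|h| in Eh.
have s0 : 0 < s by rewrite -ltcR -Eh normr_gt0.
have s1 : s <= 1 by rewrite -lecR -Eh.
have b : `|freq a m * h| <= (y * s)%:C by rewrite normrM norm_freq Eh -rmorphM.
have [{}b _] := cexp_bound b.
rewrite normrM normfV Eh -ler_pdivlMl ?invr_gt0 ?ltcR// invrK.
apply: le_trans b _; rewrite -rmorphM lecR.
have -> : 4 * pi * `|x| = y + y by rewrite /y; ring.
rewrite expRD.
have e1 : expR (y * s) <= expR y by rewrite ler_expR ler_piMr.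
have e2 : y <= expR y by have := expR_ge1Dx y; lra.
have e3 := expR_gt0 y.
have -> : 3 * (y * s) * expR (y * s) = s * (3 * (y * expR (y * s))) by ring.
by rewrite ler_wpM2l ?(ltW s0)// ler_wpM2l// ler_pM// ?expR_ge0.
Qed.

Lemma theta_term_shift a b tau h m :
  theta_term a b tau h m = cexp (freq a m * h) * theta_term a b tau 0 m.
Proof. by rewrite !theta_termE -cexpD; congr cexp; rewrite /freq; ring. Qed.

Lemma theta_term_dominated a b tau z : 1 <= im tau ->
  exists K, exp_dominated K (theta_term a b tau z).
Proof.
move=> t1; have ea (m : int) : 0 <= (m%:~R + a) ^+ 2 by rewrite sqr_ge0.
have [K hK] := theta_dominated b z 1 ea (lexx 0); exists K => m.
have D1 m' : `|1 : C| <= (1 * expR (0 * `|m'%:~R + a|))%:C.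
  by rewrite mul0r expR0 mulr1 normr1.
by have := hK tau (fun=> 1) t1 D1 m; rewrite mulr0 mul0r oppr0 cexp0 !mul1r.
Qed.

(** Tannery's theorem along h -> 0 for the difference quotients of the terms, written in the shape
    that [derive1] unfolds to. *)
Lemma theta_derivative_cvg a b tau : 1 <= im tau ->
  h^-1 *: (theta_char a%:C b tau (h + 0) - theta_char a%:C b tau 0)
    @[h --> (0 : C)^'] --> sumZ (fun m => freq a m * theta_term a b tau 0 m).
Proof.
move=> t1.
have ea (m : int) : 0 <= (m%:~R + a) ^+ 2 by rewrite sqr_ge0.
have W0 : 0 <= 4 * pi :> R by rewrite mulr_ge0 ?pi_ge0.
have [K hK] := theta_dominated b 0 3 ea W0.
have {}hK (c : int -> C) :
    (forall m, `|c m| <= (3 * expR (4 * pi * `|m%:~R + a|))%:C) ->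
    exp_dominated K (fun m => c m * theta_term a b tau 0 m).
  move=> cm m; have := hK tau c t1 cm m.
  by rewrite mulr0 mul0r oppr0 cexp0 mul1r.
have E : {near (0 : C)^',
   (fun h => sumZ (fun m => h^-1 * (cexp (freq a m * h) - 1) * theta_term a b tau 0 m)) =1
   (fun h => h^-1 *: (theta_char a%:C b tau (h + 0) - theta_char a%:C b tau 0))}.
  near=> h; rewrite addr0 !theta_charE.
  have [K1 k1] := theta_term_dominated a b h t1.
  have [K2 k2] := theta_term_dominated a b 0 t1.
  rewrite (sumZB k1 k2).
  rewrite -[RHS]/(h^-1 * _) (sumZZ _ (exp_dominatedB k1 k2)); congr sumZ; apply/funext => m.
  by rewrite [theta_term a b tau h m]theta_term_shift; ring.
apply: (cvg_trans (near_eq_cvg E)); apply: (@tannery_sumZ _ _ _ _ _ _ K).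
  by move=> m; apply: cvgMr_tmp; exact: cexp_quotient_cvg.
near=> h; apply: hK => m; apply: freq_quotient_bound.
  by near: h; exact: nbhs_dnbhs_neq.
near: h; apply: dnbhs0_le; exact: ltr01.
Unshelve. all: by end_near. Qed.

Lemma derive1_theta a b tau : 1 <= im tau ->
  derive1 (theta_char a%:C b tau) 0 =
  sumZ (fun m => freq a m * theta_term a b tau 0 m).
Proof. by move=> t1; apply: norm_cvg_lim; exact: theta_derivative_cvg. Qed.

Lemma derive1_theta1 tau : 1 <= im tau ->
  derive1 (theta1 tau) 0 = - derive1 (theta_char (1 / 2) (1 / 2) tau) 0.
Proof.
move=> t1; have -> : (1 / 2 : C) = (1 / 2)%:C by rewrite rmorphM fmorphV rmorph1 rmorph_nat.
rewrite derive1_theta//; apply: norm_cvg_lim.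
have := theta_derivative_cvg (a := 1 / 2) (b := (1 / 2)%:C) t1.
move=> /cvgN; apply: cvg_trans; apply: near_eq_cvg; near=> h.
rewrite /theta1 (_ : (1 / 2 : C) = (1 / 2)%:C); first by rewrite -opprD scalerN.
by rewrite rmorphM fmorphV rmorph1 rmorph_nat.
Unshelve. all: by end_near. Qed.

Lemma theta_cvg a e b z : (forall m : int, e <= (m%:~R + a) ^+ 2) -> 0 <= e ->
  cexp (- (cpi R * imunit R * e%:C * tau)) * theta_char a%:C b tau z
    @[tau --> im_pinfty R] -->
  sumZ (fun m => if (m%:~R + a) ^+ 2 == e then cexp (freq a m * (z + b)) else 0).
Proof.
move=> ea e0.
have D1 (m : int) : `|1 : C| <= (1 * expR (0 * `|m%:~R + a|))%:C.
  by rewrite mul0r expR0 mulr1 normr1.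
have := weighted_theta_cvg (b := b) (z := z) ea e0 (lexx 0) D1.
rewrite (_ : (fun m : int => if _ then _ else _) =
  (fun m : int => if (m%:~R + a) ^+ 2 == e then cexp (freq a m * (z + b)) else 0)).
  apply: cvg_trans; apply: near_eq_cvg; near=> tau.
  by rewrite theta_charE; congr (_ * sumZ _); apply/funext => m; rewrite mul1r.
by apply/funext => m; rewrite mul1r.
Unshelve. all: by end_near. Qed.

Lemma derive1_theta_cvg a e b : (forall m : int, e <= (m%:~R + a) ^+ 2) -> 0 <= e ->
  cexp (- (cpi R * imunit R * e%:C * tau)) * derive1 (theta_char a%:C b tau) 0
    @[tau --> im_pinfty R] -->
  sumZ (fun m => if (m%:~R + a) ^+ 2 == e then freq a m * cexp (freq a m * b) else 0).
Proof.
move=> ea e0.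
have W0 : 0 <= 2 * pi :> R by rewrite mulr_ge0 ?pi_ge0.
have D1 (m : int) : `|freq a m| <= (1 * expR (2 * pi * `|m%:~R + a|))%:C.
  rewrite norm_freq lecR mul1r.
  by have := expR_ge1Dx (2 * pi * `|m%:~R + a|); lra.
have := weighted_theta_cvg (b := b) (z := 0) ea e0 W0 D1.
rewrite (_ : (fun m : int => if _ then _ else _) =
  (fun m : int => if (m%:~R + a) ^+ 2 == e then freq a m * cexp (freq a m * b) else 0)).
  apply: cvg_trans; apply: near_eq_cvg; near=> tau.
  rewrite derive1_theta//; near: tau; exact: im_pinfty_ge.
by apply/funext => m; rewrite add0r.
Unshelve. all: by end_near. Qed.

End ThetaDerivative.

(** * Characteristics shifted by one half *)

Section LeadingTerms.
Variable R : realType.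
Local Notation C := (Cplx R).
Implicit Types (z w h b tau : C) (x y a e : R).

Lemma rcN x : (- x)%:C = - x%:C :> C. Proof. exact: rmorphN. Qed.
Lemma rcD x y : (x + y)%:C = x%:C + y%:C :> C. Proof. exact: rmorphD. Qed.
Lemma rcB x y : (x - y)%:C = x%:C - y%:C :> C. Proof. exact: rmorphB. Qed.
Lemma rcM x y : (x * y)%:C = x%:C * y%:C :> C. Proof. exact: rmorphM. Qed.
Lemma rcV x : (x^-1)%:C = (x%:C)^-1 :> C. Proof. exact: fmorphV. Qed.
Lemma rcX x n : (x ^+ n)%:C = x%:C ^+ n :> C. Proof. exact: rmorphXn. Qed.
Lemma rcn (n : nat) : (n%:R)%:C = n%:R :> C. Proof. exact: rmorph_nat. Qed.
Lemma rcz (m : int) : (m%:~R)%:C = m%:~R :> C. Proof. exact: rmorph_int. Qed.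

Definition epi z : C := cexp (cpi R * imunit R * z).

Lemma epiD z w : epi (z + w) = epi z * epi w.
Proof. by rewrite /epi mulrDr cexpD. Qed.

Lemma epiN z : epi (- z) = (epi z)^-1.
Proof. by rewrite /epi mulrN cexpN. Qed.

Lemma epiB z w : epi (z - w) = epi z / epi w.
Proof. by rewrite epiD epiN. Qed.

Lemma epi_neq0 z : epi z != 0.
Proof. exact: cexp_neq0. Qed.

Lemma epiMn (n : nat) z : epi (n%:R * z) = epi z ^+ n.
Proof. by rewrite /epi mulrCA cexpMn. Qed.

Lemma epiMz (m : int) z : epi (m%:~R * z) = epi z ^ m.
Proof. by rewrite /epi mulrCA cexpMz. Qed.

Lemma half_real : (1 / 2 : C) = (1 / 2)%:C.
Proof. by rewrite rmorphM fmorphV rmorph1 rmorph_nat. Qed.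

Lemma epi_half : epi (1 / 2) = imunit R.
Proof.
rewrite /epi half_real (_ : _ * _ = Complex 0 (pi / 2)).
  by rewrite /cexp /= cos_pihalf sin_pihalf expR0 mulr0 mulr1.
by apply/eqP; rewrite eq_complex /=; apply/andP; split; apply/eqP; ring.
Qed.

Lemma imunit_neq0 : imunit R != 0.
Proof. by rewrite -epi_half epi_neq0. Qed.

Lemma imunit_sqr : imunit R * imunit R = -1.
Proof. by apply/eqP; rewrite eq_complex /=; apply/andP; split; apply/eqP; ring. Qed.

Lemma imunitV : (imunit R)^-1 = - imunit R.
Proof.
by apply: (mulfI imunit_neq0); rewrite mulfV ?imunit_neq0// mulrN imunit_sqr opprK.
Qed.

Lemma freqE a m z : cexp (freq a m * z) = epi (2 * (m%:~R + a)%:C * z).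
Proof. by rewrite /epi /freq; congr cexp; ring. Qed.

Lemma intr_off01 (m : int) : m != 0 -> m != -1 ->
  (1 <= m%:~R :> R) \/ (m%:~R <= -2 :> R).
Proof.
move=> m0 m1; have [h|h] := leP 1 m; first by left; rewrite ler1z.
right; have -> : -2 = (-2)%:~R :> R by rewrite rmorphN.
by rewrite ler_int; lia.
Qed.

(* The minimum of |m + a + 1/2| is 1/2 - |a|, attained at m = 0 if a <= 0 and
   at m = -1 if a >= 0. *)
Lemma half_char_min a (m : int) : `|a| < 1 ->
  (`|a| - 1 / 2) ^+ 2 <= (m%:~R + (a + 1 / 2)) ^+ 2 /\
  (m != 0 -> m != -1 -> (`|a| - 1 / 2) ^+ 2 < (m%:~R + (a + 1 / 2)) ^+ 2).
Proof.
move=> a1.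
have S : m != 0 -> m != -1 -> (`|a| - 1 / 2) ^+ 2 < (m%:~R + (a + 1 / 2)) ^+ 2.
  move=> m0 m1; have := a1; rewrite ltr_norml => /andP[l u].
  have [h|h] := intr_off01 m0 m1; have [a0|a0] := leP 0 a;
    rewrite ?(ger0_norm a0) ?(ltr0_norm a0); nra.
split=> //.
have [->|m0] := eqVneq m 0.
  by have [a0|a0] := leP 0 a; rewrite ?(ger0_norm a0) ?(ltr0_norm a0); nra.
have [->|m1] := eqVneq m (-1); last exact/ltW/S.
rewrite rmorphN rmorph1.
by have [a0|a0] := leP 0 a; rewrite ?(ger0_norm a0) ?(ltr0_norm a0); nra.
Qed.

(** Coefficient of the dominant exponential of a theta with characteristics a + 1/2 and 1/2. At a =
    0 the indices 0 and -1 tie and give -2 sin(pi z); otherwise one of them wins. *)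
Definition half_lead a z : C :=
  if a == 0 then imunit R * hat (epi z)
  else epi (2 * (a - Num.sg a / 2)%:C * (z + 1 / 2)).

Lemma half_theta_cvg a z : `|a| < 1 ->
  cexp (- (cpi R * imunit R * ((`|a| - 1 / 2) ^+ 2)%:C * tau)) *
    theta_char (a%:C + 1 / 2) (1 / 2) tau z @[tau --> im_pinfty R] -->
  half_lead a z.
Proof.
move=> a1.
have := @theta_cvg R (a + 1 / 2) ((`|a| - 1 / 2) ^+ 2) (1 / 2) z
  (fun m => (half_char_min m a1).1) (sqr_ge0 _).
have -> : (a + 1 / 2)%:C = a%:C + 1 / 2 :> C by rewrite rmorphD half_real.
rewrite sumZ_finite; last first.
  move=> m m0 m1; case: ifP => // /eqP E.
  by have := (half_char_min m a1).2 m0 m1; rewrite E ltxx.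
rewrite !freqE rmorphN rmorph1 add0r.
suff -> : (if (a + 1 / 2) ^+ 2 == (`|a| - 1 / 2) ^+ 2
   then epi (2 * (a + 1 / 2)%:C * (z + 1 / 2)) else 0) +
  (if (-1 + (a + 1 / 2)) ^+ 2 == (`|a| - 1 / 2) ^+ 2
   then epi (2 * (-1 + (a + 1 / 2))%:C * (z + 1 / 2)) else 0) = half_lead a z by [].
rewrite /half_lead.
have [a0|a0|a0] := ltrgtP a 0.
- rewrite (ltr0_norm a0) ltr0_sg// ifT; last by apply/eqP; ring.
  rewrite ifF; last by apply: gt_eqF; lra.
  by rewrite addr0 (_ : a - -1 / 2 = a + 1 / 2)//; lra.
- rewrite (gtr0_norm a0) gtr0_sg// ifF; last by apply: gt_eqF; lra.
  rewrite ifT; last by apply/eqP; field.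
  by rewrite add0r (_ : -1 + (a + 1 / 2) = a - 1 / 2)//; lra.
- rewrite a0 normr0 !ifT; [|by apply/eqP; field|by apply/eqP; field].
  rewrite (_ : 0 + 1 / 2 = 1 / 2 :> R) ?add0r// (_ : -1 + 1 / 2 = - (1 / 2) :> R); last by field.
  rewrite rcN -half_real.
  rewrite (_ : 2 * (1 / 2) * (z + 1 / 2) = z + 1 / 2); last by field.
  rewrite (_ : 2 * - (1 / 2) * (z + 1 / 2) = - (z + 1 / 2)); last by field.
  rewrite epiN epiD epi_half invfM imunitV /hat; ring.
Qed.

(** The tied indices 0 and -1 contribute -pi each. *)
Lemma half_derive1_cvg :
  cexp (- (cpi R * imunit R * ((1 / 2) ^+ 2)%:C * tau)) *
    derive1 (theta_char (1 / 2) (1 / 2) tau) 0 @[tau --> im_pinfty R] -->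
  (- (2 * cpi R) : C).
Proof.
have a1 : `|0 : R| < 1 by rewrite normr0.
have H m : (1 / 2) ^+ 2 <= (m%:~R + 1 / 2) ^+ 2 :> R.
  by have := (half_char_min m a1).1; rewrite normr0 sub0r sqrrN add0r.
have := @derive1_theta_cvg R (1 / 2) ((1 / 2) ^+ 2) (1 / 2) H (sqr_ge0 _).
rewrite -half_real sumZ_finite; last first.
  move=> m m0 m1; case: ifP => // /eqP E.
  by have := (half_char_min m a1).2 m0 m1; rewrite normr0 sub0r sqrrN add0r E ltxx.
rewrite !freqE rmorphN rmorph1 add0r !ifT; [|by apply/eqP; field|by apply/eqP; field].
rewrite /freq rmorphN rmorph1 add0r (_ : -1 + 1 / 2 = - (1 / 2) :> R); last by field.
rewrite rcN -half_real.
rewrite (_ : 2 * (1 / 2) * (1 / 2) = (1 / 2 : C)); last by field.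
rewrite (_ : 2 * - (1 / 2) * (1 / 2) = - (1 / 2 : C)); last by field.
rewrite epiN epi_half imunitV.
suff -> : 2 * cpi R * imunit R * (1 / 2) * imunit R +
   2 * cpi R * imunit R * - (1 / 2) * - imunit R = - (2 * cpi R) by [].
transitivity (2 * cpi R * (imunit R * imunit R)); first by field.
by rewrite imunit_sqr; ring.
Qed.

Lemma half_lead_neq0 a z : (a == 0 -> hat (epi z) != 0) -> half_lead a z != 0.
Proof.
rewrite /half_lead; case: ifP => [_ /(_ isT) h|_ _]; last exact: epi_neq0.
by rewrite mulf_neq0 ?imunit_neq0.
Qed.

Lemma cexp_eq1 z : cexp z = 1 -> re z = 0.
Proof.
move=> h; have := norm_cexp z; rewrite h normr1 => /(congr1 re) /= /esym e1.
by apply: (@expR_inj R); rewrite expR0.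
Qed.

(** On the fractional part y in [0, 1), sin(pi y) is positive unless y = 0. Absolute values absorb
    the sign change under integer shifts. *)
Lemma sin_pi_eq0 x : sin (pi * x) = 0 -> exists m : int, x = m%:~R.
Proof.
move=> s0; exists (Num.floor x).
have P (m : int) y : `|sin (pi * (y + m%:~R))| = `|sin (pi * y)|.
  have Pn (n : nat) y' : `|sin (pi * (y' + n%:R))| = `|sin (pi * y')|.
    elim: n => [|n IH]; first by rewrite addr0.
    by rewrite -IH -natr1 addrA mulrDr mulr1 sinDpi normrN.
  case: m => n; first by rewrite -pmulrn.
  by rewrite NegzE -[in RHS](subrK n.+1%:R y) Pn rmorphN /= -pmulrn.
set y := x - (Num.floor x)%:~R.
have y0 : 0 <= y by rewrite subr_ge0 floor_le_tmp.
have y1 : y < 1 by rewrite ltrBlDr addrC -(intrD1 _) floorD1_gt.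
have : `|sin (pi * y)| = 0 by rewrite -(P (Num.floor x)) subrK s0 normr0.
move/eqP; rewrite normr_eq0 => /eqP sy.
apply/eqP; rewrite -subr_eq0 -/y eq_le y0 andbT leNgt; apply/negP => yp.
have : 0 < sin (pi * y).
  by apply: sin_gt0_pi; rewrite mulr_gt0 ?pi_gt0//= gtr_pMr ?pi_gt0.
by rewrite sy ltxx.
Qed.

(** Vanishing means exp(2 pi i z) = 1: the modulus forces Im z = 0, then the real part forces sin(pi
    Re z) = 0. *)
Lemma hat_epi_neq0 z : (forall m : int, z != m%:~R) -> hat (epi z) != 0.
Proof.
move=> zm; apply/eqP; rewrite /hat => /eqP; rewrite subr_eq0 => /eqP h.
have e1 : epi z * epi z = 1 by rewrite {1}h mulVf// epi_neq0.
have z0 : im z = 0.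
  have := cexp_eq1 (z := cpi R * imunit R * z + cpi R * imunit R * z).
  rewrite cexpD => /(_ e1) E.
  have : re (cpi R * imunit R * z + cpi R * imunit R * z) = - (2 * pi * im z).
    by case: (z) => u v /=; ring.
  rewrite E => /esym/eqP; rewrite oppr_eq0 !mulf_eq0 pnatr_eq0 /=.
  by rewrite (gt_eqF (pi_gt0 R)) /= => /eqP.
have [m xm] : exists m : int, re z = m%:~R.
  apply: sin_pi_eq0; move: e1 z0; rewrite /epi; case: (z) => u v /= + v0.
  rewrite v0 => /(congr1 re) /=.
  rewrite !(mulr0, mul0r, subr0, addr0, oppr0, add0r, sub0r) expR0 !mul1r.
  move=> E; have := cos2Dsin2 (pi * u) => E2.
  by apply/eqP; rewrite -sqrf_eq0; apply/eqP; move: E; rewrite mulr1; lra.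
have := zm m; rewrite (_ : z = m%:~R) ?eqxx//.
by rewrite -(rmorph_int (real_complex R)) -xm; case: (z) z0 => u v /= ->.
Qed.

End LeadingTerms.

(** * Limits of matrices and the gauge *)

Section MatrixLimits.
Variable R : realType.
Local Notation C := (Cplx R).
Context {T : Type} {F : set_system T} {FF : Filter F}.

Lemma cvg_mx m n (f : T -> 'M[C]_(m, n)) (l : 'M[C]_(m, n)) :
  (forall i j, f t i j @[t --> F] --> l i j) -> f t @[t --> F] --> l.
Proof.
move=> fl A [P Pn PA].
have H : \forall t \near F, forall ij : 'I_m * 'I_n, P ij.1 ij.2 (f t ij.1 ij.2).
  by apply: filter_forall => -[i j] /=; exact: fl (Pn i j).
by apply: filterS H => t ht; apply: PA => i j; exact: ht (i, j).
Qed.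

Lemma cvg_sum I (r : seq I) (P : pred I) (f : I -> T -> C) (l : I -> C) :
  (forall i, P i -> f i t @[t --> F] --> l i) ->
  \sum_(i <- r | P i) f i t @[t --> F] --> \sum_(i <- r | P i) l i.
Proof. by apply: cvg_big; exact: add_continuous. Qed.

Lemma cvg_prod_big I (r : seq I) (P : pred I) (f : I -> T -> C) (l : I -> C) :
  (forall i, P i -> f i t @[t --> F] --> l i) ->
  \prod_(i <- r | P i) f i t @[t --> F] --> \prod_(i <- r | P i) l i.
Proof. by apply: cvg_big; exact: mul_continuous. Qed.

Lemma cvg_det n (f : T -> 'M[C]_n) (l : 'M[C]_n) :
  (forall i j, f t i j @[t --> F] --> l i j) ->
  \det (f t) @[t --> F] --> \det l.
Proof.
move=> fl; apply: cvg_sum => s _; apply: cvgM; first exact: cvg_cst.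
by apply: cvg_prod_big => i _.
Qed.

Lemma cvg_cofactor n (f : T -> 'M[C]_n) (l : 'M[C]_n) i j :
  (forall i j, f t i j @[t --> F] --> l i j) ->
  cofactor (f t) i j @[t --> F] --> cofactor l i j.
Proof.
move=> fl; apply: cvgM; first exact: cvg_cst.
apply: cvg_det => k k'; rewrite !mxE.
by rewrite (_ : (fun t => _) = fun t => f t (lift i k) (lift j k'))//;
  apply/funext => t; rewrite !mxE.
Qed.

(** Cramer's rule: cofactors and determinant are polynomial in the entries, and the limit
    determinant is nonzero. *)
Lemma cvg_invmx n (f : T -> 'M[C]_n) (l : 'M[C]_n) : l \in unitmx ->
  (forall i j, f t i j @[t --> F] --> l i j) ->
  (\forall t \near F, f t \in unitmx) /\
  forall i j, invmx (f t) i j @[t --> F] --> invmx l i j.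
Proof.
move=> lu fl; have dl := cvg_det fl.
have dl0 : \det l != 0 by rewrite -unitfE -unitmxE.
have nu : \forall t \near F, f t \in unitmx.
  have : \forall t \near F, \det (f t) != 0.
    by apply: (cvgr_neq0 _ dl dl0).
  by apply: filterS => t; rewrite unitmxE unitfE.
split; first exact: nu.
move=> i j.
have V (A : 'M[C]_n) : A \in unitmx -> invmx A i j = (\det A)^-1 * cofactor A j i.
  by move=> Au; rewrite /invmx Au mxE [X in _ * X]mxE.
rewrite (V _ lu).
have E : {near F, (fun t => (\det (f t))^-1 * cofactor (f t) j i) =1 (fun t => invmx (f t) i j)}.
  by apply: filterS nu => t ft; rewrite V.
apply: (cvg_trans (near_eq_cvg E)); apply: cvgM; last exact: cvg_cofactor.
exact: cvgV.
Qed.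

Lemma cvg_mulmx m n p (f : T -> 'M[C]_(m, n)) (g : T -> 'M[C]_(n, p))
    (l : 'M[C]_(m, n)) (l' : 'M[C]_(n, p)) :
  (forall i j, f t i j @[t --> F] --> l i j) ->
  (forall i j, g t i j @[t --> F] --> l' i j) ->
  forall i j, (f t *m g t) i j @[t --> F] --> (l *m l') i j.
Proof.
move=> fl gl i j; rewrite mxE.
rewrite (_ : (fun t => _) = fun t => \sum_k f t i k * g t k j).
  by apply: cvg_sum => k _; apply: cvgM.
by apply/funext => t; rewrite mxE.
Qed.

(** Convergence of [X] is deduced by solving for it: multiply [V] by the inverses of [A^T] and [B],
    which converge. *)
Lemma cvg_solve_sandwich n (A B V X : T -> 'M[C]_n) (A0 B0 L : 'M[C]_n) :
  A0 \in unitmx -> B0 \in unitmx ->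
  (forall i j, A t i j @[t --> F] --> A0 i j) ->
  (forall i j, B t i j @[t --> F] --> B0 i j) ->
  (\forall t \near F, V t = (A t)^T *m X t *m B t) ->
  (forall i j, V t i j @[t --> F] --> (A0^T *m L *m B0) i j) ->
  forall i j, X t i j @[t --> F] --> L i j.
Proof.
move=> uA uB cA cB VE cV i j.
have cancel (A1 B1 M : 'M[C]_n) : A1 \in unitmx -> B1 \in unitmx ->
    (invmx A1)^T *m (A1^T *m M *m B1) *m invmx B1 = M.
  move=> u1 u2; rewrite -!mulmxA mulmxV// mulmx1 mulmxA -trmx_mul mulmxV//.
  by rewrite trmx1 mul1mx.
have [nA iA] := cvg_invmx uA cA.
have [nB iB] := cvg_invmx uB cB.
rewrite -(cancel A0 B0 L uA uB).
have E : {near F, (fun t => ((invmx (A t))^T *m V t *m invmx (B t)) i j) =1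
                  (fun t => X t i j)}.
  by apply: filterS3 nA nB VE => t nAt nBt ->; rewrite cancel.
apply: (cvg_trans (near_eq_cvg E)).
apply: cvg_mulmx; last exact: iB.
move=> a b; apply: cvg_mulmx; last exact: cV.
move=> {}a {}b.
rewrite mxE (_ : (fun t => _) = fun t => invmx (A t) b a); first exact: iA.
by apply/funext => t; rewrite mxE.
Qed.

End MatrixLimits.

(** * Powers of the nome and the diagonal gauge *)

Section Gauge.
Variable R : realType.
Local Notation C := (Cplx R).

(** The inverse of exp(pi i e tau): it normalises a theta series whose least exponent is e. *)
Definition nome (e : R) (tau : C) : C := cexp (- (cpi R * imunit R * e%:C * tau)).

(** The characteristic of [psi] as a theta of modulus n tau; its square is the exponent in the gauge
    entry. *)
Definition centre (n a : nat) : R := (a%:R - (n%:R - 1) / 2) / n%:R.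

Lemma centreE (n a : nat) : (0 < n)%N ->
  (centre n a)%:C = (a%:R - (n%:R - 1) / 2) / n%:R :> C.
Proof. by move=> n0; rewrite /centre !(rcM, rcB, rcV, rcn). Qed.

Lemma gauge_nome n (a : 'I_n) tau : gauge n tau a a = nome (centre n a ^+ 2) (n%:R * tau).
Proof.
have n0 : (0 < n)%N by case: (n) a => [[]|].
have nN0 : n%:R != 0 :> C by rewrite pnatr_eq0 -lt0n.
rewrite mxE eqxx /nome rcX centreE//; congr cexp; by field.
Qed.

Lemma gauge_conjE n tau (M : 'M[C]_(n * n)) r s :
  let g (a : 'I_n) := gauge n tau a a in
  let r' := mxtens_unindex r in let s' := mxtens_unindex s in
  gauge_conj tau M r s = (g r'.1 * g r'.2)^-1 * M r s * (g s'.1 * g s'.2).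
Proof.
move=> g r' s'; pose G r := let r' := @mxtens_unindex n n r in g r'.1 * g r'.2.
have gne a : g a != 0 by rewrite /g mxE eqxx cexp_neq0.
have Gne r0 : G r0 != 0 by rewrite mulf_neq0.
have D : gauge n tau *t gauge n tau = diag_mx (\row_r G r).
  apply/matrixP => i j; case: (mxtens_indexP i) => i1 i2; case: (mxtens_indexP j) => j1 j2.
  rewrite tensmxE !mxE /G /g !mxtens_indexK !mxE !eqxx.
  rewrite (can_eq (@mxtens_indexK n n)) xpair_eqE.
  by case: eqP => [->|]; case: eqP => [->|]; rewrite ?mulr1n ?mulr0n ?mulr0 ?mul0r.
have V : invmx (gauge n tau *t gauge n tau) = diag_mx (\row_r (G r)^-1).
  have E : diag_mx (\row_r (G r)^-1) *m (gauge n tau *t gauge n tau) = 1%:M.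
    rewrite D mulmx_diag; apply/matrixP => i j; rewrite !mxE mulVf//.
  have [u _] := mulmx1_unit E.
  by rewrite -[RHS]mulmx1 -(mulmxV (mulmx1_unit E).2) mulmxA E mul1mx.
rewrite /gauge_conj V D mul_diag_mx mul_mx_diag !mxE.
by [].
Qed.

End Gauge.

(** * The explicit matrix *)

Section BelavinLimit.
Variable R : realType.
Local Notation C := (Cplx R).
Implicit Types (kappa lambda tau : C).

Definition slope (n i j : nat) : R := (i%:R - j%:R) / n%:R.

Lemma slopeE (n i j : nat) : (slope n i j)%:C = (i%:R - j%:R) / n%:R :> C.
Proof. by rewrite /slope !(rcM, rcB, rcV, rcn). Qed.

Lemma norm_slope n i j : `|slope n i j| = `|i%:R - j%:R| / n%:R.
Proof. by rewrite normrM normfV (ger0_norm (ler0n _ _)). Qed.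

Lemma norm_slope_lt1 n (i j : 'I_n) : `|slope n i j| < 1.
Proof.
have n0 : 0 < n%:R :> R by rewrite ltr0n; case: (n) i => [[]|].
rewrite norm_slope ltr_pdivrMr// mul1r ltr_norml.
have := ltn_ord i; have := ltn_ord j; rewrite -!(ltr_nat R).
have := ler0n R i; have := ler0n R j; lra.
Qed.

(* A gauged coefficient is exp(pi i n tau e) times a bounded factor, where the
   exponent e collects two thetas in the numerator, two in the denominator, and
   the gauge. *)
Definition nome_exponent n (i j k l : nat) : R :=
  (1 / 2) ^+ 2 + (`|slope n i j| - 1 / 2) ^+ 2
  - (`|slope n i k| - 1 / 2) ^+ 2 - (`|slope n k j| - 1 / 2) ^+ 2
  + centre R n k ^+ 2 + centre R n l ^+ 2 - centre R n i ^+ 2 - centre R n j ^+ 2.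

(** Here s is the carry in l = i + j - k + s n. The squares of absolute values cancel against the
    gauge because |x|^2 = x^2. *)
Lemma nome_exponentE n (i j k l : nat) (s : R) : (0 < n)%N ->
  l%:R = i%:R + j%:R - k%:R + s * n%:R :> R ->
  nome_exponent n i j k l =
  (`|i%:R - k%:R| + `|k%:R - j%:R| - `|i%:R - j%:R|
   + s * (2 * (i%:R + j%:R - k%:R) - (n%:R - 1)) + s ^+ 2 * n%:R) / n%:R.
Proof.
move=> n0 El; have N0 : n%:R != 0 :> R by rewrite pnatr_eq0 -lt0n.
rewrite /nome_exponent !norm_slope /centre El.
move: (i%:R) (j%:R) (k%:R) (n%:R) N0 => I J K N N0.
have S (x : R) : `|x| ^+ 2 = x ^+ 2 by rewrite real_normK ?num_real.
have := S (I - J); have := S (I - K); have := S (K - J).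
move: `|I - J| `|I - K| `|K - J| => X Y Z EZ EY EX.
apply/eqP; rewrite -subr_eq0; apply/eqP.
transitivity (((X ^+ 2 - (I - J) ^+ 2) - (Y ^+ 2 - (I - K) ^+ 2)
  - (Z ^+ 2 - (K - J) ^+ 2)) / N ^+ 2).
  by field.
by rewrite EX EY EZ !subrr !mul0r.
Qed.

Definition between (i j k : nat) : bool := (minn i j <= k <= maxn i j)%N.

Lemma mod_sum_cases n (i j k l : 'I_n) : (i + j == k + l %[mod n])%N ->
  [\/ (i + j = k + l)%N, (i + j = k + l + n)%N | (i + j + n = k + l)%N].
Proof.
have M x : (x < n + n)%N -> (x %% n = if x < n then x else x - n)%N.
  case: (ltnP x n) => [xn _|nx xnn]; first by rewrite modn_small.
  by rewrite -{1}(subnK nx) modnDr modn_small//; lia.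
have := ltn_ord i; have := ltn_ord j; have := ltn_ord k; have := ltn_ord l.
move: (nat_of_ord i) (nat_of_ord j) (nat_of_ord k) (nat_of_ord l) => a b c d.
move=> dn cn bn an; rewrite !M; [|lia|lia].
case: (ltnP (a + b) n) => h1; case: (ltnP (c + d) n) => h2 /eqP E.
all:  solve [constructor 1; lia | constructor 2; lia | constructor 3; lia].
Qed.

(** Without carry, n times the exponent is |i-k| + |k-j| - |i-j|, zero exactly when k lies between i
    and j. With a carry it is 2(n - max(i,j)) - 1 or 2 min(i,j) + 1. *)
Lemma nome_exponent_ge0 n (i j k l : 'I_n) : (i + j == k + l %[mod n])%N ->
  if (i + j == k + l)%N && between i j k then nome_exponent n i j k l = 0
  else 0 < nome_exponent n i j k l.
Proof.
move=> mod_eq; have n0 : (0 < n)%N by exact: leq_ltn_trans (leq0n i) (ltn_ord i).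
have N0 : 0 < n%:R :> R by rewrite ltr0n.
have := ltn_ord i; have := ltn_ord j; have := ltn_ord k; have := ltn_ord l.
have := mod_sum_cases mod_eq.
move: (nat_of_ord i) (nat_of_ord j) (nat_of_ord k) (nat_of_ord l) => a b c d.
move=> + dn cn bn an.
case=> E.
- rewrite E eqxx /= (@nome_exponentE n a b c d 0)//; last first.
    by have /(congr1 (fun x => x%:R : R)) := E; rewrite !natrD; lra.
  rewrite !mul0r expr0n /= mul0r !addr0.
  rewrite /between; case: ifP => h.
    suff -> : `|a%:R - c%:R| + `|c%:R - b%:R| - `|a%:R - b%:R| = 0 :> R by rewrite mul0r.
    have [ab|/ltnW ba] := leqP a b.
      rewrite !ler0_norm ?subr_le0 ?ler_nat; [ring|lia|lia|lia].
    rewrite !ger0_norm ?subr_ge0 ?ler_nat; [ring|lia|lia|lia].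
  rewrite divr_gt0// subr_gt0.
  have : (c < minn a b)%N || (maxn a b < c)%N by lia.
  move=> /orP[hc|hc].
    have h1 : c%:R < a%:R :> R by rewrite ltr_nat; lia.
    have h2 : c%:R < b%:R :> R by rewrite ltr_nat; lia.
    rewrite (@gtr0_norm _ (a%:R - c%:R)) ?subr_gt0// (@ltr0_norm _ (c%:R - b%:R)) ?subr_lt0//.
    by rewrite ltr_norml; lra.
  have h1 : a%:R < c%:R :> R by rewrite ltr_nat; lia.
  have h2 : b%:R < c%:R :> R by rewrite ltr_nat; lia.
  rewrite (@ltr0_norm _ (a%:R - c%:R)) ?subr_lt0// (@gtr0_norm _ (c%:R - b%:R)) ?subr_gt0//.
  by rewrite ltr_norml; lra.
- have -> : (a + b == c + d)%N = false by lia.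
  have E' := congr1 (fun x => x%:R : R) E; rewrite /= !natrD in E'.
  rewrite (@nome_exponentE n a b c d (-1))//; last lra.
  rewrite divr_gt0// .
  (* As j < n, i - k = l + (n - j) >= l + 1, and likewise for j - k: k is below both i and j. *)
  have h1 : d%:R + 1 <= a%:R - c%:R :> R.
    by rewrite lerBrDr natr1 -natrD ler_nat; lia.
  have h2 : d%:R + 1 <= b%:R - c%:R :> R.
    by rewrite lerBrDr natr1 -natrD ler_nat; lia.
  have d0 := ler0n R d.
  rewrite (@gtr0_norm _ (a%:R - c%:R)); last lra.
  rewrite (@ltr0_norm _ (c%:R - b%:R)); last lra.
  have : `|a%:R - b%:R| <= a%:R + b%:R - 2 * c%:R - 2 * d%:R - 2 * 1 :> R.
    by rewrite ler_norml; lra.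
  lra.
- have -> : (a + b == c + d)%N = false by lia.
  have E' := congr1 (fun x => x%:R : R) E; rewrite /= !natrD in E'.
  rewrite (@nome_exponentE n a b c d 1)//; last lra.
  rewrite divr_gt0// .
  (* As l < n, k - i = j + (n - l) >= j + 1, and likewise for k - j: k is above both i and j. *)
  have h1 : b%:R + 1 <= c%:R - a%:R :> R.
    by rewrite lerBrDr natr1 -natrD ler_nat; lia.
  have h2 : a%:R + 1 <= c%:R - b%:R :> R.
    by rewrite lerBrDr natr1 -natrD ler_nat; lia.
  have a0 := ler0n R a; have b0 := ler0n R b.
  rewrite (@ltr0_norm _ (a%:R - c%:R)); last lra.
  rewrite (@gtr0_norm _ (c%:R - b%:R)); last lra.
  have [ab|ba] := leP 0 (a%:R - b%:R : R).
    by rewrite ger0_norm; lra.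
  by rewrite ltr0_norm; lra.
Qed.

Definition belavin_lead n kappa lambda (i j k l : 'I_n) : C :=
  if (i + j == k + l)%N && between i j k then
    - (2 * cpi R) * half_lead (slope n i j) (lambda - kappa)
    / (half_lead (slope n i k) (- kappa) * half_lead (slope n k j) lambda)
  else 0.

(** [nome_exponent] in multiplicative form, free of divisions so that it can be substituted into a
    field identity. *)
Lemma nome_exponentP n (i j k l : 'I_n) tau :
  let T := n%:R * tau in
  cexp (cpi R * imunit R * (nome_exponent n i j k l)%:C * T)
  * (nome ((1 / 2) ^+ 2) T * nome ((`|slope n i j| - 1 / 2) ^+ 2) T
     * (nome (centre R n k ^+ 2) T * nome (centre R n l ^+ 2) T)) =
  nome ((`|slope n i k| - 1 / 2) ^+ 2) T * nome ((`|slope n k j| - 1 / 2) ^+ 2) T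
  * (nome (centre R n i ^+ 2) T * nome (centre R n j ^+ 2) T).
Proof.
move=> T; rewrite /nome -!cexpD /nome_exponent !(rcD, rcB); congr cexp; ring.
Qed.

(** Each theta is paired with its normalising factor, so the quotient converges; the leftover powers
    form exp(pi i n tau e), which is 1 or tends to 0 by [nome_exponent_ge0]. *)
Lemma belavin_coef_cvg n kappa lambda (i j k l : 'I_n) :
  (forall m : int, kappa != m%:~R) -> (forall m : int, lambda != m%:~R) ->
  gauge_conj tau (belavin_R n kappa lambda tau)
    (mxtens_index (k, l)) (mxtens_index (i, j)) @[tau --> im_pinfty R] -->
  belavin_lead kappa lambda i j k l.
Proof.
move=> hk hl; have n0 : (0 < n)%N by exact: leq_ltn_trans (leq0n i) (ltn_ord i).
pose th a (z tau : C) := theta_char (a%:C + 1 / 2) (1 / 2) (n%:R * tau) z.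
pose D (tau : C) := derive1 (theta_char (1 / 2) (1 / 2) (n%:R * tau : C)) 0.
pose e1 := (`|slope n i j| - 1 / 2) ^+ 2.
pose e2 := (`|slope n i k| - 1 / 2) ^+ 2.
pose e3 := (`|slope n k j| - 1 / 2) ^+ 2.
pose main tau := (nome ((1 / 2) ^+ 2) (n%:R * tau) * D tau)
   * (nome e1 (n%:R * tau) * th (slope n i j) (lambda - kappa) tau)
   / ((nome e2 (n%:R * tau) * th (slope n i k) (- kappa) tau)
      * (nome e3 (n%:R * tau) * th (slope n k j) lambda tau))
   * cexp (cpi R * imunit R * (nome_exponent n i j k l)%:C * (n%:R * tau)).
have entryE tau : gauge_conj tau (belavin_R n kappa lambda tau)
    (mxtens_index (k, l)) (mxtens_index (i, j)) =
    if (i + j == k + l %[mod n])%N then main tau else 0.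
  rewrite gauge_conjE !mxtens_indexK /= !gauge_nome mxE !mxtens_indexK /=.
  case: ifP => _; last by rewrite mulr0 mul0r.
  have P := nome_exponentP i j k l tau.
  rewrite -/e1 -/e2 -/e3 /= in P.
  rewrite /main -!slopeE -/(th (slope n i j) (lambda - kappa) tau)
    -/(th (slope n i k) (- kappa) tau) -/(th (slope n k j) lambda tau).
  rewrite -/(D tau) !invfM.
  have N x : nome x (n%:R * tau) != 0 by exact: cexp_neq0.
  have := N ((1 / 2) ^+ 2); have := N e1; have := N e2; have := N e3.
  have := N (centre R n k ^+ 2); have := N (centre R n l ^+ 2).
  move: P.
  move: (nome ((1 / 2) ^+ 2) (n%:R * tau)) (nome e1 (n%:R * tau))
    (nome e2 (n%:R * tau)) (nome e3 (n%:R * tau)) (nome (centre R n k ^+ 2) (n%:R * tau))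
    (nome (centre R n l ^+ 2) (n%:R * tau)) (nome (centre R n i ^+ 2) (n%:R * tau))
    (nome (centre R n j ^+ 2) (n%:R * tau)) => A B E G gk gl gi gj.
  (* The inverses of the thetas become opaque variables, so the identity holds for every [tau], even
     at zeros of the thetas. *)
  move: (cexp _) (D tau) (th _ _ tau) (th (slope n i k) (- kappa) tau)^-1
    (th (slope n k j) lambda tau)^-1 => Q d t1 u v P l0 k0 G0 E0 B0 A0.
  transitivity (d * t1 * u * v / (gk * gl * E * G) * (E * G * (gi * gj))).
    by field; rewrite l0 k0 G0 E0.
  by rewrite -P; field; rewrite l0 k0 G0 E0.
rewrite (funext entryE) /belavin_lead {entryE}.
case: (boolP (i + j == k + l %[mod n])%N) => [mod_eq|nmod]; last first.
  rewrite ifF; first exact: cvg_cst.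
  by apply/negbTE/negP => /andP[/eqP E _]; rewrite E eqxx in nmod.
have cT (f : C -> C) (x : C) : f tau @[tau --> im_pinfty R] --> x ->
    f (n%:R * tau) @[tau --> im_pinfty R] --> x.
  exact: cvg_comp (im_pinfty_natM n0).
pose pre tau := (nome ((1 / 2) ^+ 2) (n%:R * tau) * D tau)
   * (nome e1 (n%:R * tau) * th (slope n i j) (lambda - kappa) tau)
   / ((nome e2 (n%:R * tau) * th (slope n i k) (- kappa) tau)
      * (nome e3 (n%:R * tau) * th (slope n k j) lambda tau)).
have main_cvg : pre tau @[tau --> im_pinfty R] -->
    - (2 * cpi R) * half_lead (slope n i j) (lambda - kappa)
    / (half_lead (slope n i k) (- kappa) * half_lead (slope n k j) lambda).
  apply: cvgM.
    apply: cvgM.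
      exact: (cT (fun T => nome _ T * derive1 (theta_char (1 / 2) (1 / 2) T) 0) _
        (half_derive1_cvg (R := R))).
    exact: (cT (fun T => nome e1 T * theta_char ((slope n i j)%:C + 1 / 2) (1 / 2) T (lambda - kappa)) _
        (half_theta_cvg (z := (lambda - kappa)) (norm_slope_lt1 i j))).
  apply: cvgV.
    rewrite mulf_neq0//; apply: half_lead_neq0 => _; apply: hat_epi_neq0 => // m.
    by apply/eqP => E; have /eqP := hk (- m); apply; rewrite rmorphN /= -E opprK.
  apply: cvgM.
    exact: (cT (fun T => nome e2 T * theta_char ((slope n i k)%:C + 1 / 2) (1 / 2) T (- kappa)) _
        (half_theta_cvg (z := (- kappa)) (norm_slope_lt1 i k))).
  exact: (cT (fun T => nome e3 T * theta_char ((slope n k j)%:C + 1 / 2) (1 / 2) T lambda) _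
        (half_theta_cvg (z := lambda) (norm_slope_lt1 k j))).
have := nome_exponent_ge0 mod_eq; case: ifP => _ he.
  rewrite (_ : main = pre); first exact: main_cvg.
  by apply/funext => tau; rewrite /main he mulr0 mul0r cexp0 mulr1.
rewrite -[X in _ --> X](mulr0 (- (2 * cpi R) * half_lead (slope n i j) (lambda - kappa)
    / (half_lead (slope n i k) (- kappa) * half_lead (slope n k j) lambda))).
exact: cvgM main_cvg (cT (fun T => cexp (_ * T)) _ (nome_cvg0 he)).
Qed.

End BelavinLimit.

(** * Cremmer-Gervais coefficients *)

Section FieldIdentities.
Variable F : fieldType.
Implicit Types (J K L P Q X E D U s : F).

(** Here and below J stands for i, K and L for q - 1/q and eta - 1/eta, P for pi. *)
Lemma cg_diag J K L P X : J * J = -1 -> J != 0 -> K != 0 -> L != 0 ->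
  2 * P * J / (K * L) * X = - (2 * P) * (J * - X) / (J * - K * (J * L)).
Proof. by move=> JJ J0 K0 L0; field: JJ; rewrite oppr_eq0 J0 K0 L0. Qed.

Lemma cg_fixed J K L P E Q D : J * J = -1 -> J != 0 -> K != 0 -> L != 0 -> D != 0 ->
  2 * P * J / (K * L) * (E * (- L * Q)) = - (2 * P) * (D * E * Q) / (J * - K * D).
Proof. by move=> JJ J0 K0 L0 D0; field: JJ; rewrite ?oppr_eq0 J0 K0 L0 D0. Qed.

Lemma cg_swap J K L P E U D : J * J = -1 -> J != 0 -> K != 0 -> L != 0 -> D != 0 ->
  2 * P * J / (K * L) * (E * (K * U)) = - (2 * P) * (D * E * U) / (D * (J * L)).
Proof. by move=> JJ J0 K0 L0 D0; field: JJ; rewrite ?oppr_eq0 J0 K0 L0 D0. Qed.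

(* E1, E2, D2, D3 and s stand for the powers of exp(pi i lambda), of
   exp(pi i kappa), the two leading terms of the denominator, and sgn(j - i). *)
Lemma cg_between J K L P E1 E2 s D2 D3 : K != 0 -> L != 0 -> D2 != 0 -> D3 != 0 ->
  2 * P * J / (K * L) * (E1 * (E2 * (s * L * K))) =
  - (2 * P) * (D2 * D3 * E1 * E2 * - (s * J)) / (D2 * D3).
Proof. by move=> K0 L0 D20 D30; field; rewrite K0 L0 D20 D30. Qed.

End FieldIdentities.

(** * Leading coefficients against Cremmer-Gervais coefficients *)

Section CremmerGervais.
Variable R : realType.
Local Notation C := (Cplx R).
Implicit Types (kappa lambda z : C).

Lemma rc1 : 1%:C = 1 :> C. Proof. by []. Qed.

(** The scalar of the theorem, as read off from the coefficient with i = j = k = l. *)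
Definition cg_scale lambda kappa : C :=
  2 * cpi R * imunit R / (hat (epi kappa) * hat (epi lambda)).

Lemma slope_opp n (i j : nat) : slope R n j i = - slope R n i j.
Proof. by rewrite /slope -mulNr opprB. Qed.

Lemma slope_eq n (i : nat) : slope R n i i = 0.
Proof. by rewrite /slope subrr mul0r. Qed.

Lemma epi_slope_eq n (i : nat) z : epi (2 * (slope R n i i)%:C * z) = 1.
Proof.
have -> : 2 * (slope R n i i)%:C * z = 0 by rewrite slope_eq; ring.
by rewrite /epi mulr0 cexp0.
Qed.

Lemma half_lead_lt n (i j : nat) z : (0 < n)%N -> (i < j)%N ->
  half_lead (slope R n i j) z = epi ((2 * (slope R n i j)%:C + 1) * (z + 1 / 2)).
Proof.
move=> n0 ij.
have s0 : slope R n i j < 0.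
  by rewrite /slope pmulr_llt0 ?invr_gt0 ?ltr0n// subr_lt0 ltr_nat.
move: (slope R n i j) s0 => a s0.
rewrite /half_lead (lt_eqF s0) (ltr0_sg s0) rcB rcM rcV rcN rcn rc1.
by rewrite (_ : 2 * (a%:C - -1 / 2) = 2 * a%:C + 1)//; field.
Qed.

Lemma half_lead_gt n (i j : nat) z : (0 < n)%N -> (j < i)%N ->
  half_lead (slope R n i j) z = epi ((2 * (slope R n i j)%:C - 1) * (z + 1 / 2)).
Proof.
move=> n0 ij.
have s0 : 0 < slope R n i j.
  by rewrite /slope pmulr_lgt0 ?invr_gt0 ?ltr0n// subr_gt0 ltr_nat.
move: (slope R n i j) s0 => a s0.
rewrite /half_lead (gt_eqF s0) (gtr0_sg s0) rcB rcM rcV rcn rc1.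
by rewrite (_ : 2 * (a%:C - 1 / 2) = 2 * a%:C - 1)//; field.
Qed.

Lemma half_lead_eq n (i : nat) z :
  half_lead (slope R n i i) z = imunit R * hat (epi z).
Proof. by rewrite slope_eq /half_lead eqxx. Qed.

Lemma hatN z : hat (epi (- z)) = - hat (epi z).
Proof. by rewrite /hat epiN invrK opprB. Qed.

Lemma epi_pow_slope n (j k : nat) kappa : (0 < n)%N ->
  epi (kappa / n%:R) ^ (2 * (Posz j - Posz k)) = epi (2 * (slope R n j k)%:C * kappa).
Proof.
move=> n0; have N0 : n%:R != 0 :> C by rewrite pnatr_eq0 -lt0n.
rewrite -epiMz intrM intrB -!pmulrn slopeE; congr epi.
by field.
Qed.

Lemma sgn_diff_lt (i j : nat) : (i < j)%N -> sgn_diff i j = -1.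
Proof. by move=> ij; rewrite /sgn_diff ltr0_sg// subr_lt0 ltz_nat. Qed.

Lemma sgn_diff_gt (i j : nat) : (j < i)%N -> sgn_diff i j = 1.
Proof. by move=> ij; rewrite /sgn_diff gtr0_sg// subr_gt0 ltz_nat. Qed.

Lemma twisted_coefE n kappa lambda (i j k l : 'I_n) :
  twisted_CG n (1 / (2 * n%:R)) 0 kappa lambda
    (mxtens_index (k, l)) (mxtens_index (i, j)) =
  epi (2 * (slope R n i k)%:C * lambda)
  * CG_coef (epi kappa) (epi (kappa / n%:R)) (epi lambda) i j k l.
Proof.
have n0 : (0 < n)%N by exact: leq_ltn_trans (leq0n i) (ltn_ord i).
have N0 : n%:R != 0 :> C by rewrite pnatr_eq0 -lt0n.
rewrite /twisted_CG mxE !mxtens_indexK /= !(mulr0, mul0r) cexp0 mulr1.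
rewrite slopeE {3}/epi.
have -> : cexp (cpi R * imunit R * kappa / n%:R) = epi (kappa / n%:R).
  by rewrite /epi mulrA.
by congr (_ * _); rewrite /epi; congr cexp; field.
Qed.

(** Branch by branch in [CG_coef]: the signs of the slopes select the leading exponentials, which
    match once the powers of p, q and eta are split off. *)
Lemma CG_lead n kappa lambda (i j k l : 'I_n) :
  (forall m : int, kappa != m%:~R) -> (forall m : int, lambda != m%:~R) ->
  cg_scale lambda kappa * (epi (2 * (slope R n i k)%:C * lambda)
  * CG_coef (epi kappa) (epi (kappa / n%:R)) (epi lambda) i j k l) =
  belavin_lead kappa lambda i j k l.
Proof.
move=> hk hl.
have n0 : (0 < n)%N by exact: leq_ltn_trans (leq0n i) (ltn_ord i).
have Hk := hat_epi_neq0 hk; have Hl := hat_epi_neq0 hl.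
have J0 := imunit_neq0 R.
have JJ := imunit_sqr R.
rewrite /CG_coef epi_pow_slope// /belavin_lead /cg_scale -!val_eqE /=.
move: (nat_of_ord i) (nat_of_ord j) (nat_of_ord k) (nat_of_ord l).
move=> {i j k l} a b c d.
case: ifP => c1.
  have [-> -> ->] : [/\ a = d, b = d & c = d] by split; lia.
  rewrite ifT; last by rewrite /between; lia.
  rewrite !half_lead_eq !epi_slope_eq !mul1r.
  have -> : epi kappa * (epi lambda)^-1 = epi (- (lambda - kappa)) by rewrite opprB epiB.
  have -> : hat (epi (lambda - kappa)) = - hat (epi (- (lambda - kappa))).
    by rewrite hatN opprK.
  rewrite [hat (epi (- kappa))]hatN; exact: cg_diag.
case: ifP => c2.
  have [-> -> dc] : [/\ a = c, b = d & d != c] by split; lia.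
  rewrite ifT; last by rewrite /between; lia.
  rewrite epi_slope_eq mul1r half_lead_eq hatN.
  have [cd|{}dc] : (c < d)%N \/ (d < c)%N by lia.
    rewrite sgn_diff_lt// !half_lead_lt// -[_ ^ (-1)]/(epi kappa)^-1.
    have -> : epi ((2 * (slope R n c d)%:C + 1) * (lambda - kappa + 1 / 2)) =
        epi ((2 * (slope R n c d)%:C + 1) * (lambda + 1 / 2)) *
        epi (2 * (slope R n d c)%:C * kappa) * (epi kappa)^-1.
      by rewrite -epiN -!epiD slope_opp rcN; congr epi; ring.
    by apply: cg_fixed; rewrite ?epi_neq0.
  rewrite sgn_diff_gt// !half_lead_gt// expr1z.
  have -> : epi ((2 * (slope R n c d)%:C - 1) * (lambda - kappa + 1 / 2)) =
      epi ((2 * (slope R n c d)%:C - 1) * (lambda + 1 / 2)) *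
      epi (2 * (slope R n d c)%:C * kappa) * epi kappa.
    by rewrite -!epiD slope_opp rcN; congr epi; ring.
  by apply: cg_fixed; rewrite ?epi_neq0.
case: ifP => c3.
  rewrite ifT; last by rewrite /between; lia.
  have Sab : (slope R n a b)%:C = (slope R n a c)%:C + (slope R n c b)%:C :> C.
    by rewrite -rcD /slope -mulrDl; congr (_%:C); congr (_ / _); ring.
  have Sbc : (slope R n b c)%:C = - (slope R n c b)%:C :> C by rewrite slope_opp rcN.
  have [[ac cb]|[bc ca]] : (a < c /\ c < b)%N \/ (b < c /\ c < a)%N by lia.
    have ab := ltn_trans ac cb.
    rewrite sgn_diff_gt// !half_lead_lt// rmorph1.
    (* The denominator has an extra half shift; what remains is exp(-pi i/2) = -i, the source of
       sgn(j - i). *)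
    have -> : epi ((2 * (slope R n a b)%:C + 1) * (lambda - kappa + 1 / 2)) =
      epi ((2 * (slope R n a c)%:C + 1) * (- kappa + 1 / 2)) *
      epi ((2 * (slope R n c b)%:C + 1) * (lambda + 1 / 2)) *
      epi (2 * (slope R n a c)%:C * lambda) *
      epi (2 * (slope R n b c)%:C * kappa) * - (1 * imunit R).
      rewrite [1 * imunit R]mul1r -imunitV -epi_half -epiN -!epiD Sab Sbc; congr epi; by field.
    by apply: cg_between; rewrite ?epi_neq0.
  have ba := ltn_trans bc ca.
  rewrite sgn_diff_lt// !half_lead_gt// rmorphN rmorph1.
  have -> : epi ((2 * (slope R n a b)%:C - 1) * (lambda - kappa + 1 / 2)) =
    epi ((2 * (slope R n a c)%:C - 1) * (- kappa + 1 / 2)) *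
    epi ((2 * (slope R n c b)%:C - 1) * (lambda + 1 / 2)) *
    epi (2 * (slope R n a c)%:C * lambda) *
    epi (2 * (slope R n b c)%:C * kappa) * - (-1 * imunit R).
    rewrite [-1 * imunit R]mulN1r opprK -epi_half -!epiD Sab Sbc; congr epi; by field.
  by apply: cg_between; rewrite ?epi_neq0.
case: ifP => c4.
  have [-> -> dc] : [/\ b = c, a = d & d != c] by split; lia.
  rewrite ifT; last by rewrite /between; lia.
  rewrite epi_slope_eq mul1r half_lead_eq.
  have [cd|{}dc] : (c < d)%N \/ (d < c)%N by lia.
    rewrite sgn_diff_lt// !half_lead_gt// -[_ ^ (-1)]/(epi lambda)^-1.
    have -> : epi ((2 * (slope R n d c)%:C - 1) * (lambda - kappa + 1 / 2)) =
        epi ((2 * (slope R n d c)%:C - 1) * (- kappa + 1 / 2)) *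
        epi (2 * (slope R n d c)%:C * lambda) * (epi lambda)^-1.
      by rewrite -epiN -!epiD; congr epi; ring.
    by apply: cg_swap; rewrite ?epi_neq0.
  rewrite sgn_diff_gt// !half_lead_lt// expr1z.
  have -> : epi ((2 * (slope R n d c)%:C + 1) * (lambda - kappa + 1 / 2)) =
      epi ((2 * (slope R n d c)%:C + 1) * (- kappa + 1 / 2)) *
      epi (2 * (slope R n d c)%:C * lambda) * epi lambda.
    by rewrite -!epiD; congr epi; ring.
  by apply: cg_swap; rewrite ?epi_neq0.
(* Outside the four branches, i + j differs from k + l or k is not between i and j. *)
rewrite !mulr0 ifF//; apply/negbTE; rewrite /between.
by move: c1 c2 c3 c4; lia.
Qed.

End CremmerGervais.

(** * The trigonometric operator *)

Section TrigonometricOperator.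
Variable R : realType.
Local Notation C := (Cplx R).
Implicit Types (kappa lambda z w : C).

(* Dividing the Cremmer-Gervais coefficients by (q - 1/q)(eta - 1/eta) puts the
   three cases i < j, i = j, i > j under a single formula. *)
Definition cg_weight kappa lambda (i j k : nat) : C :=
  ((i <= k < j)%N)%:R - ((j <= k < i)%N)%:R
  + (k == j)%:R * (epi lambda / hat (epi lambda))
  - (k == i)%:R * (epi kappa / hat (epi kappa)).

(** The half-open ranges produce the signs in the exponents: at k = i < j, for instance, 1 - q/(q -
    1/q) = -q^{-1}/(q - 1/q). *)
Lemma CG_coefE n kappa lambda (p : C) (i j k l : 'I_n) :
  hat (epi kappa) != 0 -> hat (epi lambda) != 0 ->
  CG_coef (epi kappa) p (epi lambda) i j k l =
  if (i + j == k + l)%N then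
    p ^ (2 * (Posz j - Posz k)) *
    (hat (epi kappa) * hat (epi lambda) * cg_weight kappa lambda i j k)
  else 0.
Proof.
move=> Hk Hl.
have -> : hat (epi kappa) * hat (epi lambda) * cg_weight kappa lambda i j k =
    hat (epi kappa) * hat (epi lambda) * (((i <= k < j)%N)%:R - ((j <= k < i)%N)%:R)
    + (k == j :> nat)%:R * (hat (epi kappa) * epi lambda)
    - (k == i :> nat)%:R * (hat (epi lambda) * epi kappa).
  rewrite /cg_weight; move: (hat _) (hat _) (_%:R) (_%:R) (_%:R) (_%:R) Hk Hl.
  by move=> p1 p2 p3 p4 p5 p6 p10 p20; field; rewrite p10 p20.
rewrite /CG_coef -!val_eqE /=.
move: (nat_of_ord i) (nat_of_ord j) (nat_of_ord k) (nat_of_ord l).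
move=> {i j k l} a b c d.
move: (epi_neq0 kappa) (epi_neq0 lambda); move: (epi kappa) (epi lambda) {Hk Hl}.
move=> q eta q0 e0.
case: ifP => c1.
  have [-> -> ->] : [/\ a = d, b = d & c = d] by split; lia.
  have -> : (d <= d < d)%N = false by lia.
  by rewrite !eqxx; congr (_ * _); rewrite /hat /=; field; rewrite q0 e0.
case: ifP => c2.
  have [-> -> dc] : [/\ a = c, b = d & d != c] by split; lia.
  have -> : (c == d) = false by lia.
  have -> : (d <= c < c)%N = false by lia.
  rewrite !eqxx.
  have [cd|{}dc] : (c < d)%N \/ (d < c)%N by lia.
    have -> : (c <= c < d)%N by lia.
    rewrite sgn_diff_lt// -[_ ^ (-1)]/q^-1; congr (_ * _); rewrite /hat /=.
    by field; rewrite q0 e0.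
  have -> : (c <= c < d)%N = false by lia.
  rewrite sgn_diff_gt// expr1z; congr (_ * _); rewrite /hat /=.
  by field; rewrite q0 e0.
case: ifP => c3.
  have -> : (a + b == c + d)%N by lia.
  have -> : (c == b) = false by lia.
  have -> : (c == a) = false by lia.
  have [[ac cb]|[bc ca]] : (a < c /\ c < b)%N \/ (b < c /\ c < a)%N by lia.
    have -> : (a <= c < b)%N by lia.
    have -> : (b <= c < a)%N = false by lia.
    by rewrite sgn_diff_gt ?(ltn_trans ac cb)// rmorph1 /=; ring.
  have -> : (a <= c < b)%N = false by lia.
  have -> : (b <= c < a)%N by lia.
  by rewrite sgn_diff_lt ?(ltn_trans bc ca)// rmorphN rmorph1 /=; ring.
case: ifP => c4.
  have [-> -> dc] : [/\ b = c, a = d & d != c] by split; lia.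
  have -> : (c == d) = false by lia.
  have -> : (d <= c < c)%N = false by lia.
  rewrite [(c + d)%N]addnC !eqxx.
  have [cd|{}dc] : (c < d)%N \/ (d < c)%N by lia.
    have -> : (c <= c < d)%N by lia.
    rewrite sgn_diff_lt// -[_ ^ (-1)]/eta^-1; congr (_ * _); rewrite /hat /=.
    by field; rewrite q0 e0.
  have -> : (c <= c < d)%N = false by lia.
  rewrite sgn_diff_gt// expr1z; congr (_ * _); rewrite /hat /=.
  by field; rewrite q0 e0.
rewrite mulr0; case: ifP => // s.
have -> : (a <= c < b)%N = false by lia.
have -> : (b <= c < a)%N = false by lia.
have -> : (c == b) = false by lia.
have -> : (c == a) = false by lia.
by rewrite /=; ring.
Qed.

Lemma geometric_range (F : fieldType) (t : F) (i j : nat) : t != 1 -> (i <= j)%N ->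
  \sum_(i <= k < j) t ^+ k = (t ^+ j - t ^+ i) / (t - 1).
Proof.
move=> t1; have {}t1 : t - 1 != 0 by rewrite subr_eq0.
move=> ij; rewrite -(subnKC ij); elim: (j - i)%N => [|m IH].
  by rewrite addn0 big_geq// subrr mul0r.
by rewrite addnS big_nat_recr ?leq_addr//= IH exprS; field.
Qed.

(** The signed half-open ranges sum to (t^j - t^i)/(t - 1) for either order of i and j. *)
Lemma sum_cg_weight n kappa lambda (t : C) (i j : 'I_n) : t != 1 ->
  \sum_(k < n) cg_weight kappa lambda i j k * t ^+ k =
  (1 / (t - 1) + epi lambda / hat (epi lambda)) * t ^+ j
  - (1 / (t - 1) + epi kappa / hat (epi kappa)) * t ^+ i.
Proof.
move=> t1.
pose S (a b : nat) := \sum_(k < n) ((a <= k < b)%N)%:R * t ^+ k.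
have SE (a b : nat) : (b <= n)%N -> S a b = \sum_(a <= k < b) t ^+ k.
  move=> bn; rewrite /S.
  rewrite (eq_bigr (fun k : 'I_n => if (a <= k < b)%N then t ^+ k else 0)); last first.
    by move=> k _; case: ifP; rewrite ?mul1r ?mul0r.
  rewrite -big_mkcond /= -(big_mkord (fun k => (a <= k < b)%N) (fun k => t ^+ k)).
  rewrite [RHS](big_nat_widen _ _ n)//= [RHS](big_nat_widenl _ 0)//=.
  by apply: eq_bigl => k; rewrite andbC.
have D (a : 'I_n) : \sum_(k < n) (k == a :> nat)%:R * t ^+ k = t ^+ a.
  rewrite (bigD1 a)//= eqxx mul1r big1 ?addr0// => k.
  by rewrite -val_eqE /= => /negbTE ->; rewrite mul0r.
transitivity (S i j - S j i + t ^+ j * (epi lambda / hat (epi lambda))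
   - t ^+ i * (epi kappa / hat (epi kappa))).
  rewrite /S -(D i) -(D j) !mulr_suml -!sumrB -big_split -sumrB /=.
  by apply: eq_bigr => k _; rewrite /cg_weight; ring.
have E : S i j - S j i = (t ^+ j - t ^+ i) / (t - 1).
  have [ij|ji] := leqP i j.
    rewrite !SE ?(ltnW (ltn_ord _))// (geometric_range t1 ij) (big_geq ij).
    by rewrite subr0.
  have ji' := ltnW ji.
  rewrite !SE ?(ltnW (ltn_ord _))// (geometric_range t1 ji') (big_geq ji').
  by rewrite sub0r -mulNr opprB.
have {}t1 : t - 1 != 0 by rewrite subr_eq0.
by rewrite E; ring.
Qed.

Definition mode n (a : nat) z : C := epi (2 * (a%:R - (n%:R - 1) / 2) * z).

(** This is pi sin(pi(w + lambda)) / (sin(pi w) sin(pi lambda)). *)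
Definition G_trig w lambda : C :=
  2 * cpi R * imunit R * hat (epi (w + lambda)) / (hat (epi w) * hat (epi lambda)).

(** Partial fractions: w separates from lambda, and the pole part is the same in both terms of the
    operator. *)
Lemma G_trigE w lambda : hat (epi w) != 0 -> hat (epi lambda) != 0 ->
  G_trig w lambda = 2 * cpi R * imunit R *
    (1 / (epi (2 * w) - 1) + epi lambda / hat (epi lambda)).
Proof.
have -> : epi (2 * w) = epi w * epi w by rewrite -epiD; congr epi; ring.
rewrite /G_trig epiD; have := epi_neq0 w; have := epi_neq0 lambda.
move: (epi w) (epi lambda) => x y y0 x0; rewrite /hat => hx hy.
have hx' : x * x - 1 != 0.
  by apply: contra_neq hx => h; rewrite (_ : x - x^-1 = (x * x - 1) / x); [rewrite h mul0r|field].
have hy' : y * y - 1 != 0.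
  by apply: contra_neq hy => h; rewrite (_ : y - y^-1 = (y * y - 1) / y); [rewrite h mul0r|field].
rewrite -[LHS]mulrA; congr (_ * _); field.
by rewrite x0 y0 hx' hy'.
Qed.

(** With t = exp(2 pi i w), the mode products in the two terms are a common factor times t^j and
    t^i; the right-hand side is that factor times the sum in [sum_cg_weight]. *)
Lemma trig_operator n kappa lambda (i j : 'I_n) z1 z2 :
  (forall m : int, kappa != m%:~R) -> (forall m : int, lambda != m%:~R) ->
  let w := z1 - z2 - (lambda + kappa) / n%:R in
  hat (epi w) != 0 ->
  G_trig w lambda * (mode n i (z2 + lambda / n%:R) * mode n j (z1 - lambda / n%:R))
  - G_trig w kappa * (mode n i (z1 - kappa / n%:R) * mode n j (z2 + kappa / n%:R))
  = \sum_(k < n) \sum_(l < n)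
      cg_scale lambda kappa * twisted_CG n (1 / (2 * n%:R)) 0 kappa lambda
        (mxtens_index (k, l)) (mxtens_index (i, j)) * (mode n k z1 * mode n l z2).
Proof.
move=> hk hl w hw.
have n0 : (0 < n)%N by exact: leq_ltn_trans (leq0n i) (ltn_ord i).
have N0 : n%:R != 0 :> C by rewrite pnatr_eq0 -lt0n.
have Hk := hat_epi_neq0 hk; have Hl := hat_epi_neq0 hl.
set t := epi (2 * w).
have t1 : t != 1.
  apply: contra_neq hw => h; rewrite /hat.
  have : epi w * epi w = 1 by rewrite -epiD -h; congr epi; ring.
  move=> h2; apply/eqP; rewrite subr_eq0; apply/eqP.
  by apply: (mulfI (epi_neq0 w)); rewrite h2 mulfV// epi_neq0.
(* Factor common to the two terms of the operator and to all modes of the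
   right-hand side; what remains is an identity of rational functions of t. *)
pose K0 := epi (- (n%:R - 1) * (z1 + z2) + 2 * (i%:R * lambda / n%:R)
   + 2 * (j%:R * kappa / n%:R) + 2 * (i%:R + j%:R) * z2).
have tX (k : nat) : t ^+ k = epi (2 * k%:R * w) by rewrite -epiMn; congr epi; ring.
have -> : mode n i (z2 + lambda / n%:R) * mode n j (z1 - lambda / n%:R) = K0 * t ^+ j.
  by rewrite tX /mode -!epiD; congr epi; rewrite /w; field.
have -> : mode n i (z1 - kappa / n%:R) * mode n j (z2 + kappa / n%:R) = K0 * t ^+ i.
  by rewrite tX /mode -!epiD; congr epi; rewrite /w; field.
have row (k : 'I_n) : \sum_(l < n)
      cg_scale lambda kappa * twisted_CG n (1 / (2 * n%:R)) 0 kappa lambda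
        (mxtens_index (k, l)) (mxtens_index (i, j)) * (mode n k z1 * mode n l z2) =
    2 * cpi R * imunit R * K0 * (cg_weight kappa lambda i j k * t ^+ k).
  have term (l : 'I_n) : cg_scale lambda kappa * twisted_CG n (1 / (2 * n%:R)) 0 kappa lambda
        (mxtens_index (k, l)) (mxtens_index (i, j)) * (mode n k z1 * mode n l z2) =
      if (i + j == k + l)%N then
        2 * cpi R * imunit R * K0 * (cg_weight kappa lambda i j k * t ^+ k)
      else 0.
    rewrite twisted_coefE CG_coefE//; case: eqP => E; last by rewrite !mulr0 mul0r.
    have El : l%:R = i%:R + j%:R - k%:R :> C by rewrite -natrD E natrD; ring.
    have EE : epi (2 * (slope R n i k)%:C * lambda) * epi (2 * (slope R n j k)%:C * kappa)
        * (mode n k z1 * mode n l z2) = K0 * t ^+ k.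
      by rewrite tX /mode -!epiD !slopeE El; congr epi; rewrite /w; field.
    rewrite epi_pow_slope// /cg_scale.
    transitivity (2 * cpi R * imunit R * cg_weight kappa lambda i j k *
      (epi (2 * (slope R n i k)%:C * lambda) * epi (2 * (slope R n j k)%:C * kappa)
        * (mode n k z1 * mode n l z2))); last by rewrite EE; ring.
    move: (epi (2 * (slope R n i k)%:C * lambda)) (epi (2 * (slope R n j k)%:C * kappa)).
    move: (mode n k z1) (mode n l z2) (cg_weight _ _ _ _ _) => p1 p2 p3 p4 p5.
    move: Hk Hl; move: (hat (epi kappa)) (hat (epi lambda)) => p6 p7 p60 p70.
    by field; rewrite p60 p70.
  rewrite (eq_bigr _ (fun l _ => term l)).
  (* If k lies between i and j, then l = i + j - k is a legal index and the only one contributing;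
     otherwise the weight vanishes. *)
  have [kij|kij] := boolP (between i j k).
    have lt_l : (i + j - k < n)%N.
      have := ltn_ord i; have := ltn_ord j; move: kij; rewrite /between.
      by move: (nat_of_ord i) (nat_of_ord j) (nat_of_ord k) => *; lia.
    rewrite (bigD1 (Ordinal lt_l))//= ifT; last first.
      move: kij; rewrite /between.
      by move: (nat_of_ord i) (nat_of_ord j) (nat_of_ord k) => *; lia.
    rewrite big1 ?addr0// => l; rewrite -val_eqE /= => ll; rewrite ifF//.
    move: ll kij; rewrite /between.
    by move: (nat_of_ord i) (nat_of_ord j) (nat_of_ord k) (nat_of_ord l) => *; lia.
  have -> : cg_weight kappa lambda i j k = 0.
    move: kij; rewrite /between /cg_weight.
    move: (nat_of_ord i) (nat_of_ord j) (nat_of_ord k) => a b c h.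
    have -> : (a <= c < b)%N = false by lia.
    have -> : (b <= c < a)%N = false by lia.
    have -> : (c == b) = false by lia.
    have -> : (c == a) = false by lia.
    by rewrite /=; ring.
  by rewrite mul0r mulr0; apply: big1 => l _; case: ifP.
rewrite (eq_bigr _ (fun k _ => row k)) -mulr_sumr sum_cg_weight//.
by rewrite !G_trigE//; ring.
Qed.

End TrigonometricOperator.

(** * The elliptic operator *)

Section EllipticOperator.
Variable R : realType.
Local Notation C := (Cplx R).
Implicit Types (kappa lambda tau z w : C).

Lemma centre_bound n (a : nat) : (a < n)%N -> `|centre R n a| < 1 / 2.
Proof.
move=> an; have n0 : 0 < n%:R :> R by rewrite ltr0n; exact: leq_ltn_trans an.
rewrite normrM normfV (gtr0_norm n0) ltr_pdivrMr// ltr_norml.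
have h : a%:R + 1 <= n%:R :> R by rewrite natr1 ler_nat.
have := ler0n R a; lra.
Qed.

(** Strictness for m != 0 excludes the tie that occurs at 1/2, so [psi] has a single dominant
    term. *)
Lemma centre_min (x : R) (m : int) : `|x| < 1 / 2 ->
  x ^+ 2 <= (m%:~R + x) ^+ 2 /\ (m != 0 -> x ^+ 2 < (m%:~R + x) ^+ 2).
Proof.
rewrite ltr_norml => /andP[l u].
have S : m != 0 -> x ^+ 2 < (m%:~R + x) ^+ 2.
  move=> m0; have [->|m1] := eqVneq m (-1); first by rewrite rmorphN rmorph1; nra.
  by have [h|h] := intr_off01 R m0 m1; nra.
split=> //; have [->|m0] := eqVneq m 0; first by rewrite add0r.
exact/ltW/S.
Qed.

Lemma psiE n (a : nat) tau z : (0 < n)%N ->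
  psi n tau a z = theta_char (centre R n a)%:C 0 (n%:R * tau) (n%:R * z).
Proof.
move=> n0; have N0 : n%:R != 0 :> C by rewrite pnatr_eq0 -lt0n.
rewrite /psi /theta_char; congr sumZ; apply/funext => m.
by rewrite centreE//; congr cexp; field.
Qed.

(** The gauge entry is exactly the factor normalising the dominant term m = 0. *)
Lemma psi_cvg n (a : 'I_n) z :
  gauge n tau a a * psi n tau a z @[tau --> im_pinfty R] --> mode n a z.
Proof.
have n0 : (0 < n)%N by exact: leq_ltn_trans (leq0n a) (ltn_ord a).
have N0 : n%:R != 0 :> C by rewrite pnatr_eq0 -lt0n.
have cb := centre_bound (ltn_ord a).
have := @theta_cvg R (centre R n a) (centre R n a ^+ 2) 0 (n%:R * z)
  (fun m => (centre_min m cb).1) (sqr_ge0 _).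
rewrite sumZ_finite; last first.
  move=> m m0 _; case: ifP => // /eqP E.
  by have := (centre_min m cb).2 m0; rewrite E ltxx.
rewrite add0r eqxx ifF; last by apply/gt_eqF/(centre_min (-1) cb).2.
rewrite addr0 addr0 freqE add0r.
have -> : 2 * (centre R n a)%:C * (n%:R * z) = 2 * (a%:R - (n%:R - 1) / 2) * z.
  by rewrite centreE//; field.
move=> h.
rewrite (_ : (fun tau => _) = (fun tau => nome (centre R n a ^+ 2) (n%:R * tau) *
   theta_char (centre R n a)%:C 0 (n%:R * tau) (n%:R * z))); last first.
  by apply/funext => tau; rewrite gauge_nome psiE.
exact: cvg_comp (im_pinfty_natM n0) h.
Qed.

Lemma theta1_cvg z :
  nome ((1 / 2) ^+ 2) tau * theta1 tau z @[tau --> im_pinfty R] -->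
  - (imunit R * hat (epi z)).
Proof.
have a0 : `|0 : R| < 1 by rewrite normr0.
have := half_theta_cvg (z := z) a0.
rewrite /half_lead eqxx normr0 sub0r sqrrN add0r => /cvgN.
by apply: cvg_trans; apply: near_eq_cvg; near=> tau; rewrite /= /theta1 mulrN.
Unshelve. all: by end_near. Qed.

Lemma derive1_theta1_cvg :
  nome ((1 / 2) ^+ 2) tau * derive1 (theta1 tau) 0 @[tau --> im_pinfty R] -->
  (2 * cpi R : C).
Proof.
have := half_derive1_cvg (R := R) => /cvgN; rewrite opprK.
apply: cvg_trans; apply: near_eq_cvg; near=> tau.
rewrite derive1_theta1 ?mulrN//; near: tau; exact: im_pinfty_ge.
Unshelve. all: by end_near. Qed.

Lemma theta1_near_neq0 z : hat (epi z) != 0 ->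
  \forall tau \near im_pinfty R, theta1 tau z != 0.
Proof.
move=> hz.
have l0 : - (imunit R * hat (epi z)) != 0 by rewrite oppr_eq0 mulf_neq0 ?imunit_neq0.
have : \forall tau \near im_pinfty R, nome ((1 / 2) ^+ 2) tau * theta1 tau z != 0.
  exact: (cvgr_neq0 _ (@theta1_cvg z) l0).
by apply: filterS => tau; rewrite mulf_eq0 negb_or => /andP[].
Qed.

(** Numerator and denominator have two factors of order exp(pi i tau/4) each, so the normalisations
    cancel. *)
Lemma G_theta_cvg w lambda : hat (epi w) != 0 -> hat (epi lambda) != 0 ->
  G_theta tau w lambda @[tau --> im_pinfty R] --> G_trig w lambda.
Proof.
move=> hw hl; have J0 := imunit_neq0 R; have JJ := imunit_sqr R.
pose th z (tau : C) := nome ((1 / 2) ^+ 2) tau * theta1 tau z.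
have -> : G_trig w lambda = 2 * cpi R * - (imunit R * hat (epi (w + lambda)))
    / (- (imunit R * hat (epi w)) * - (imunit R * hat (epi lambda))).
  rewrite /G_trig; move: (hat (epi (w + lambda))) (hat (epi w)) (hat (epi lambda)) hw hl.
  move: (imunit R) JJ J0 => J JJ J0 h1 h2 h3 h20 h30.
  by field: JJ; rewrite ?oppr_eq0 h20 h30 J0.
rewrite (_ : (fun tau => _) = fun tau =>
  (nome ((1 / 2) ^+ 2) tau * derive1 (theta1 tau) 0) * th (w + lambda) tau
  / (th w tau * th lambda tau)); last first.
  apply/funext => tau; rewrite /G_theta /th !invfM.
  have := cexp_neq0 (- (cpi R * imunit R * ((1 / 2) ^+ 2)%:C * tau)).
  rewrite -/(nome _ _); move: (nome _ _) (derive1 _ _) (theta1 tau (w + lambda)).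
  move: (theta1 tau w)^-1 (theta1 tau lambda)^-1 => x1 x2 x3 x4 x5 x30.
  by field.
apply: cvgM; first by apply: cvgM; [exact: derive1_theta1_cvg|exact: theta1_cvg].
apply: cvgV; first by rewrite mulf_neq0 ?oppr_eq0 ?mulf_neq0.
by apply: cvgM; exact: theta1_cvg.
Qed.

Definition sample_mx n (s : 'I_n -> C) : 'M[C]_n := \matrix_(k, a) mode n k (s a).

(** A Vandermonde matrix times an invertible diagonal one; its nodes have moduli proportional to
    exp(-2 pi a), hence are distinct. *)
Lemma sample_mx_unit n z0 :
  sample_mx (fun a : 'I_n => imunit R * a%:R + z0) \in unitmx.
Proof.
pose s (a : 'I_n) : C := imunit R * a%:R + z0.
pose x : 'rV[C]_n := \row_a epi (2 * s a).
have E : sample_mx s = Vandermonde n x *m diag_mx (\row_a epi (- (n%:R - 1) * s a)).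
  apply/matrixP => k a; rewrite mul_mx_diag !mxE /mode -epiMn -epiD; congr epi.
  by field.
have norm_x a : `|x 0 a| = (expR (- (2 * pi * a%:R) + re (cpi R * imunit R * (2 * z0))))%:C.
  rewrite mxE norm_cexp; congr (expR _)%:C.
  rewrite (_ : cpi R * imunit R * (2 * s a) = (- (2 * pi * a%:R))%:C + cpi R * imunit R * (2 * z0)).
    by rewrite ReD.
  rewrite /s rcN !rcM !rcn -[pi%:C]/(cpi R).
  transitivity (2 * cpi R * a%:R * (imunit R * imunit R) + cpi R * imunit R * (2 * z0)).
    by ring.
  by rewrite imunit_sqr; ring.
rewrite -/s E unitmx_mul; apply/andP; split; last first.
  rewrite unitmxE det_diag unitfE; apply/prodf_neq0 => i _.
  by rewrite mxE epi_neq0.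
rewrite unitmxE det_Vandermonde unitfE; apply/prodf_neq0 => i _.
apply/prodf_neq0 => j ij; rewrite subr_eq0; apply: contraTneq ij => xx.
have := norm_x i; rewrite -xx norm_x => -[] /expR_inj /addIr /oppr_inj.
have p0 : 2 * pi != 0 :> R by rewrite mulf_neq0 ?pnatr_eq0 ?gt_eqF ?pi_gt0.
move=> /(mulfI p0) /eqP; rewrite eqr_nat => /eqP ->.
by rewrite ltnn.
Qed.

Lemma half_shift_nonint (a b : nat) :
  hat (epi (imunit R * (a%:R - b%:R) + 1 / 2)) != 0.
Proof.
apply: hat_epi_neq0 => m; apply/eqP => /(congr1 re).
rewrite ReD half_real /= -(rcz R m) /= -(rcn R a) -(rcn R b) -rcB /=.
rewrite mul0r mulr0 subrr add0r => h.
have h2 : 1 = (m * 2)%:~R :> R by rewrite intrM -h; field.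
have /eqP := h2; rewrite -[1]/(1%:~R) eqr_int => /eqP; lia.
Qed.

(** For fixed (i, j) the operator identity on a grid determines the column (i, j) of [RB], and
    [cvg_solve_sandwich] gives its limit. *)
Lemma shibukawa_ueno_mx_cvg n kappa lambda (RB : C -> 'M[C]_(n * n)) (i j k l : 'I_n) :
  (forall m : int, kappa != m%:~R) -> (forall m : int, lambda != m%:~R) ->
  (\forall tau \near im_pinfty R, shibukawa_ueno_mx kappa lambda tau (RB tau)) ->
  gauge_conj tau (RB tau) (mxtens_index (k, l)) (mxtens_index (i, j))
    @[tau --> im_pinfty R] -->
  cg_scale lambda kappa * twisted_CG n (1 / (2 * n%:R)) 0 kappa lambda
    (mxtens_index (k, l)) (mxtens_index (i, j)).
Proof.
move=> hk hl hRB.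
have n0 : (0 < n)%N by exact: leq_ltn_trans (leq0n i) (ltn_ord i).
have N0 : n%:R != 0 :> C by rewrite pnatr_eq0 -lt0n.
have Hk := hat_epi_neq0 hk; have Hl := hat_epi_neq0 hl.
(* On this grid z1 - z2 - (lambda + kappa)/n = 1/2 + i (a - b), which is never an
   integer, and the nodes exp(2 pi i z) have pairwise distinct moduli. *)
pose s1 (a : 'I_n) : C := imunit R * a%:R + ((lambda + kappa) / n%:R + 1 / 2).
pose s2 (b : 'I_n) : C := imunit R * b%:R + 0.
pose w (a b : 'I_n) : C := s1 a - s2 b - (lambda + kappa) / n%:R.
have hw a b : hat (epi (w a b)) != 0.
  rewrite (_ : w a b = imunit R * (a%:R - b%:R) + 1 / 2) ?half_shift_nonint//.
  by rewrite /w /s1 /s2; ring.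
pose alpha : C := 1 / (2 * n%:R); pose beta : C := kappa / (2 * n%:R).
have wE a b : s1 a - s2 b - 2 * (alpha * lambda + beta) = w a b.
  by rewrite /w /alpha /beta; field.
pose g (a : 'I_n) tau := gauge n tau a a.
have g0 a tau : g a tau != 0 by rewrite /g mxE eqxx cexp_neq0.
pose phi (s : 'I_n -> C) tau : 'M[C]_n := \matrix_(k, a) (g k tau * psi n tau k (s a)).
(* The gauged column (i, j), reshaped into an n x n matrix. *)
pose X tau : 'M[C]_n := \matrix_(k, l)
  gauge_conj tau (RB tau) (mxtens_index (k, l)) (mxtens_index (i, j)).
pose V tau : 'M[C]_n := \matrix_(a, b)
   (g i tau * g j tau * shibukawa_ueno tau alpha beta kappa lambda
      (fun x y => psi n tau i x * psi n tau j y) (s1 a) (s2 b)).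
pose L : 'M[C]_n := \matrix_(k, l) (cg_scale lambda kappa *
   twisted_CG n (1 / (2 * n%:R)) 0 kappa lambda (mxtens_index (k, l)) (mxtens_index (i, j))).
have phi_cvg s k' a : phi s tau k' a @[tau --> im_pinfty R] --> sample_mx s k' a.
  rewrite mxE (_ : (fun tau => _) = fun tau => g k' tau * psi n tau k' (s a)).
    exact: psi_cvg.
  by apply/funext => tau; rewrite mxE.
have u1 : sample_mx s1 \in unitmx by exact: sample_mx_unit.
have u2 : sample_mx s2 \in unitmx by exact: sample_mx_unit.
have lin : \forall tau \near im_pinfty R, V tau = (phi s1 tau)^T *m X tau *m phi s2 tau.
  (* The grid is finite, so for Im tau large no grid point is a pole. *)
  have nz : \forall tau \near im_pinfty R, forall ab : 'I_n * 'I_n,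
      theta1 tau (w ab.1 ab.2) != 0.
    by apply: filter_forall => -[a b]; exact: theta1_near_neq0.
  near=> tau.
  have hR : shibukawa_ueno_mx kappa lambda tau (RB tau) by near: tau.
  have hz (ab : 'I_n * 'I_n) : theta1 tau (w ab.1 ab.2) != 0.
    by move: ab; near: tau.
  apply/matrixP => a b; rewrite [LHS]mxE.
  have /= -> := hR i j (s1 a) (s2 b); last by rewrite wE; exact: (hz (a, b)).
  rewrite mxE mulr_sumr; under [RHS]eq_bigr => l' _ do rewrite mxE mulr_suml.
  rewrite [RHS]exchange_big /=; apply: eq_bigr => k' _.
  rewrite mulr_sumr; apply: eq_bigr => l' _.
  rewrite [_^T _ _]mxE [phi s1 tau _ _]mxE [phi s2 tau _ _]mxE [X tau _ _]mxE gauge_conjE.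
  rewrite !mxtens_indexK /= -/(g k' tau) -/(g l' tau) -/(g i tau) -/(g j tau).
  have := g0 k' tau; have := g0 l' tau.
  move: (g k' tau) (g l' tau) (g i tau) (g j tau) => x1 x2 x3 x4 x20 x10.
  by field; rewrite x20 x10.
have V_cvg a b : V tau a b @[tau --> im_pinfty R] -->
    ((sample_mx s1)^T *m L *m sample_mx s2) a b.
  (* By [trig_operator] the target is the trigonometric operator evaluated at a grid point. *)
  have -> : ((sample_mx s1)^T *m L *m sample_mx s2) a b =
    G_trig (w a b) lambda * (mode n i (s2 b + lambda / n%:R) * mode n j (s1 a - lambda / n%:R))
    - G_trig (w a b) kappa * (mode n i (s1 a - kappa / n%:R) * mode n j (s2 b + kappa / n%:R)).
    rewrite (trig_operator _ _ hk hl (hw a b)).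
    rewrite mxE; under eq_bigr => l' _ do rewrite mxE mulr_suml.
    rewrite exchange_big /=; apply: eq_bigr => k' _.
    by apply: eq_bigr => l' _; rewrite !mxE; ring.
  rewrite (_ : (fun tau => _) = fun tau =>
    G_theta tau (w a b) lambda * ((g i tau * psi n tau i (s2 b + lambda / n%:R)) *
      (g j tau * psi n tau j (s1 a - lambda / n%:R)))
    - G_theta tau (w a b) kappa * ((g i tau * psi n tau i (s1 a - kappa / n%:R)) *
      (g j tau * psi n tau j (s2 b + kappa / n%:R)))); last first.
    apply/funext => tau; rewrite mxE /shibukawa_ueno wE.
    have -> : 2 * alpha * lambda = lambda / n%:R by rewrite /alpha; field.
    have -> : 2 * beta = kappa / n%:R by rewrite /beta; field.
    by ring.
  apply: cvgB; apply: cvgM; first exact: G_theta_cvg.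
  - by apply: cvgM; exact: psi_cvg.
  - exact: G_theta_cvg.
  - by apply: cvgM; exact: psi_cvg.
have XE tau : X tau k l =
    gauge_conj tau (RB tau) (mxtens_index (k, l)) (mxtens_index (i, j)).
  by rewrite [LHS]mxE.
have LE : L k l = cg_scale lambda kappa * twisted_CG n (1 / (2 * n%:R)) 0 kappa lambda
    (mxtens_index (k, l)) (mxtens_index (i, j)) by rewrite [LHS]mxE.
rewrite -(funext XE) -LE.
exact: (cvg_solve_sandwich u1 u2 (phi_cvg s1) (phi_cvg s2) lin V_cvg).
Unshelve. all: by end_near. Qed.

End EllipticOperator.

(** * Common limit of the explicit matrix and of the operator's matrix *)

Theorem theorem4p5 (R : realType) :
  exists c : Cplx R -> Cplx R -> Cplx R,
    forall (n : nat) (kappa lambda : Cplx R),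
      (1 <= n)%N ->
      (forall m : int, kappa != m%:~R) ->
      (forall m : int, lambda != m%:~R) ->
      [/\ c lambda kappa != 0,
          gauge_conj tau (belavin_R n kappa lambda tau)
            @[tau --> im_pinfty R]
            --> c lambda kappa *: twisted_CG n (1 / (2 * n%:R)) 0 kappa lambda
        & forall RB : Cplx R -> 'M[Cplx R]_(n * n),
            (\forall tau \near im_pinfty R,
               shibukawa_ueno_mx kappa lambda tau (RB tau)) ->
            gauge_conj tau (RB tau) @[tau --> im_pinfty R]
              --> c lambda kappa
                  *: twisted_CG n (1 / (2 * n%:R)) 0 kappa lambda].
Proof.
exists (@cg_scale R) => n kappa lambda _ hk hl.
have Hk := hat_epi_neq0 hk; have Hl := hat_epi_neq0 hl.
have c0 : cg_scale lambda kappa != 0.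
  have p0 : cpi R != 0 by rewrite eq_complex /= eqxx andbT gt_eqF ?pi_gt0.
  by rewrite !mulf_neq0 ?invr_eq0 ?mulf_neq0 ?pnatr_eq0 ?imunit_neq0.
split=> // [|RB hRB]; apply: cvg_mx => r s; rewrite mxE;
  case: (mxtens_indexP r) => k l; case: (mxtens_indexP s) => i j.
  by rewrite twisted_coefE CG_lead//; exact: belavin_coef_cvg.
exact: shibukawa_ueno_mx_cvg.
Qed.
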